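(* Consider the network of $N$ agents described in the context, where each agent is either a Hammerstein system or a Wiener system and the controls $u_{i,k}$ are generated by the distributed algorithm described in the context. Assume: (A1) the polynomials $C_i(z)$, $i\in\mathcal N$, are stable, i.e., the roots of $C_i(z)$ are outside the unit disk; (A2) (i) $f_i$, $i\in\mathcal N$, are continuous; (ii) there exists an (unknown) constant $\mu>0$ such that $|f_i(u)|=O(|u|^\mu)$ as $|u|\to\infty$ for all $i\in\mathcal N$; (iii) $h_i:\mathbb R\to\mathbb R$, $i\in\mathcal N$, are strictly monotonically increasing and have range $(-\infty,+\infty)$; (A3) $\{\epsilon_{ij,k}\}_{k\ge1}$, $i\in\mathcal N$, $j\in\mathcal N_i$, are mutually independent sequences with $\mathbb E\,\epsilon_{ij,k}=0$ and $\sup_k\mathbb E|\epsilon_{ij,k}|^2<\infty$; (A4) $\mathcal G$ is a connected and undirected graph. Then applying the algorithm to the multi-agent system leads to output consensus: $$y_{i,k}\xrightarrow[k\to\infty]{} y^0\quad\text{a.s. for all } i\in\mathcal N,$$ where $y^0=y^0(\omega)$ may depend on the sample $\omega$ and is such that $|y^0|<\infty$ a.s., and $y^0\mathbf 1_N=\mathbf h(\mathbf u^0)$, where $\mathbf u^0=\lim_{k\to\infty}\mathbf u_k$ (which may depend on the sample), $\mathbf u_k=[u_{1,k},\dots,u_{N,k}]^T$, $\mathbf h(\mathbf u)=[h_1(u_1),\dots,h_N(u_N)]^T$, and $\mathbf 1_N$ is the all-ones vector in $\mathbb R^N$.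
   Context: **Network.** $\mathcal G=(\mathcal N,\mathcal E)$ is an undirected graph on $\mathcal N=\{1,\dots,N\}$ without self-loops; $\mathcal N_i=\{j:(j,i)\in\mathcal E\}$. Adjacency matrix $P=[p_{ij}]$: $p_{ij}>0$ if $j\in\mathcal N_i$, $p_{ij}=0$ otherwise. **Agents.** $f_i:\mathbb R\to\mathbb R$; $C_i(z)=1+c_{i,1}z+\dots+c_{i,p}z^p$, $D_i(z)=1+d_{i,1}z+\dots+d_{i,q}z^q$ are real polynomials ($p,q$ may depend on $i$), where $z$ also denotes the backward shift operator, $z\,y_{i,k+1}=y_{i,k}$. Agent $i$ with input $u_{i,k}$, internal variable $v_{i,k}$ and output $y_{i,k}$ (all real) is either - a Hammerstein system: $v_{i,k}=f_i(u_{i,k})$, $C_i(z)y_{i,k+1}=D_i(z)v_{i,k}$; or - a Wiener system: $C_i(z)v_{i,k+1}=D_i(z)u_{i,k}$, $y_{i,k+1}=f_i(v_{i,k+1})$. The recursions are started from given initial values. Put $c_i=1+\sum_{s=1}^pc_{i,s}$ and $d_i=1+\sum_{s=1}^qd_{i,s}$ ($c_i=C_i(1)\neq0$ under (A1)), and $$h_i(u)=\begin{cases}\frac{d_i}{c_i}f_i(u)&\text{if agent } i \text{ is a Hammerstein system},\\ f_i\big(\frac{d_i}{c_i}u\big)&\text{if agent } i\text{ is a Wiener system}.\end{cases}$$ **Observations.** Agent $i$ observes its own output and $z_{ij,k+1}=y_{j,k+1}+\epsilon_{ij,k+1}$ for $j\in\mathcal N_i$, where $\epsilon_{ij,k+1}$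 is random observation noise on a probability space $\Omega$. **Algorithm.** Let $a_k=1/k$, $M_k=\ln(k+c_M)$, with fixed reals $u_i^*$ and a constant $c_M>0$ such that $|u_i^*|<M_0$ for all $i$. With $\sigma_{i,1}=0$, for $k\ge1$ and $i\in\mathcal N$ ($I$ denotes an indicator): $$\sigma'_{i,k}=\max\{\sigma_{i,k},\ \sigma_{j,k}: j\in\mathcal N_i\},\qquad u'_{i,k}=u_{i,k}I_{\{\sigma'_{i,k}=\sigma_{i,k}\}}+u_i^*I_{\{\sigma'_{i,k}>\sigma_{i,k}\}},$$ $$O_{i,k+1}=\sum_{j\in\mathcal N_i}p_{ij}(z_{ij,k+1}-y_{i,k+1}),$$ $$u_{i,k+1}=(u'_{i,k}+a_kO_{i,k+1})I_{\{|u'_{i,k}+a_kO_{i,k+1}|<M_{\sigma'_{i,k}}\}}+u_i^*I_{\{|u'_{i,k}+a_kO_{i,k+1}|\ge M_{\sigma'_{i,k}}\}},$$ $$\sigma_{i,k+1}=\sigma'_{i,k}+I_{\{|u'_{i,k}+a_kO_{i,k+1}|\ge M_{\sigma'_{i,k}}\}}.$$ *)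

(* Defs.v *)
From mathcomp Require Import all_boot all_order all_algebra.
From mathcomp Require Import finmap complex.
From mathcomp Require Import all_classical all_reals all_analysis.

Set Implicit Arguments.
Unset Strict Implicit.
Unset Printing Implicit Defensive.

Import Order.TTheory GRing.Theory Num.Theory.
Import numFieldNormedType.Exports.

Local Open Scope classical_set_scope.
Local Open Scope ring_scope.

Inductive agent_kind := Hammerstein | Wiener.

(* The polynomials C, D have constant term 1 and no prescribed degree, so each
   agent has its own orders p and q. *)
Record agent (R : realType) := Agent {
  kind : agent_kind;
  nonlin : R -> R;
  polC : {poly R};
  polD : {poly R};
  polC0 : polC`_0 = 1;
  polD0 : polD`_0 = 1
}.

(* (C(z) x)_k, with z the backward shift. Time is int: the recursions below are
   imposed from time 1 on, so that the values before are free initial values. *)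
Definition shift_apply (R : realType) (C : {poly R}) (x : int -> R) (k : int)
  : R := \sum_(s < size C) C`_s * x (k - s%:Z).

Definition agent_dynamics (R : realType) (A : agent R) (u v y : int -> R)
  : Prop :=
  forall k : nat, (1 <= k)%N ->
  match kind A with
  | Hammerstein =>
      v k%:Z = nonlin A (u k%:Z) /\
      shift_apply (polC A) y k.+1%:Z = shift_apply (polD A) v k%:Z
  | Wiener =>
      shift_apply (polC A) v k.+1%:Z = shift_apply (polD A) u k%:Z /\
      y k.+1%:Z = nonlin A (v k.+1%:Z)
  end.

Definition static_map (R : realType) (A : agent R) (x : R) : R :=
  match kind A with
  | Hammerstein => (polD A).[1] / (polC A).[1] * nonlin A x
  | Wiener => nonlin A ((polD A).[1] / (polC A).[1] * x)
  end.

Definition static_map_vec (R : realType) (N : nat) (A : 'I_N -> agent R)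
  (x : 'cV[R]_N) : 'cV[R]_N := \col_i static_map (A i) (x i 0).

Definition stable_poly (R : realType) (C : {poly R}) : Prop :=
  forall x : R[i], root (map_poly (real_complex R) C) x -> 1 < `|x|.

Definition bigO_power (R : realType) (f : R -> R) (mu : R) : Prop :=
  exists K B : R, forall u : R, B <= `|u| -> `|f u| <= K * `|u| `^ mu.

(* j is a neighbour of i iff e j i. The weights are not required to satisfy
   p i j = p j i; only the edge relation of an undirected graph is symmetric. *)
Definition adjacency_matrix (R : realType) (N : nat) (e : rel 'I_N)
  (p : 'M[R]_N) : Prop :=
  forall i j, (e j i -> 0 < p i j) /\ (~~ e j i -> p i j = 0).

Definition undirected_graph (N : nat) (e : rel 'I_N) : Prop :=
  symmetric e /\ irreflexive e.

Definition connected_graph (N : nat) (e : rel 'I_N) : Prop :=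
  forall i j, connect e i j.

Definition mutually_independent (d : measure_display) (T : measurableType d)
  (R : realType) (P : probability T R) (I : choiceType) (A : set I)
  (X : I -> {RV P >-> R}) : Prop :=
  forall (J : {fset I}) (B : I -> set R),
    [set` J] `<=` A -> (forall i, measurable (B i)) ->
    P (\bigcap_(i in [set` J]) (X i @^-1` B i)) =
    (\prod_(i <- J) P (X i @^-1` B i))%E.

Definition step_size (R : realType) (k : nat) : R := k%:R^-1.

Definition trunc_bound (R : realType) (cM : R) (k : nat) : R := ln (k%:R + cM).

(* The algorithm along one sample path: eps i j k is the noise on agent i's
   observation of y_j at time k. *)
Definition max_sigma (N : nat) (e : rel 'I_N) (sigma : 'I_N -> nat -> nat)
  (i : 'I_N) (k : nat) : nat :=
  maxn (sigma i k) (\max_(j | e j i) sigma j k).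

Definition reset_control (R : realType) (N : nat) (e : rel 'I_N)
  (ustar : 'I_N -> R) (u : 'I_N -> int -> R) (sigma : 'I_N -> nat -> nat)
  (i : 'I_N) (k : nat) : R :=
  if max_sigma e sigma i k == sigma i k then u i k%:Z else ustar i.

Definition observed (R : realType) (N : nat) (y : 'I_N -> int -> R)
  (eps : 'I_N -> 'I_N -> nat -> R) (i j : 'I_N) (k : nat) : R :=
  y j k%:Z + eps i j k.

Definition innovation (R : realType) (N : nat) (e : rel 'I_N) (p : 'M[R]_N)
  (y : 'I_N -> int -> R) (eps : 'I_N -> 'I_N -> nat -> R)
  (i : 'I_N) (k : nat) : R :=
  \sum_(j | e j i) p i j * (observed y eps i j k - y i k%:Z).

Definition consensus_algorithm (R : realType) (N : nat) (e : rel 'I_N)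
  (p : 'M[R]_N) (ustar : 'I_N -> R) (cM : R)
  (eps : 'I_N -> 'I_N -> nat -> R) (y u : 'I_N -> int -> R)
  (sigma : 'I_N -> nat -> nat) : Prop :=
  (forall i, sigma i 1%N = 0%N) /\
  (forall (i : 'I_N) (k : nat), (1 <= k)%N ->
     let s := max_sigma e sigma i k in
     let x := reset_control e ustar u sigma i k
              + step_size R k * innovation e p y eps i k.+1 in
     let M := trunc_bound cM s in
     u i k.+1%:Z = (if `|x| < M then x else ustar i) /\
     sigma i k.+1 = (s + (M <= `|x|)%R)%N).

(* Main.v *)
(* Let L be the graph Laplacian of the weights and pi > 0 a left null vector
   of L. While no control is truncated, the controls plus the tails of the
   (almost surely convergent) series of a_k times the observation noise satisfy
   w_(k+1) = w_k - a_k L y_(k+1) exactly, so the weighted sum pi . w_k is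
   conserved; and y_(k+1) is close to h(w_k) once the controls have moved slowly
   for long enough, because the linear parts of the agents are stable filters.
   The function V(w) = sum_i pi_i H_i(w_i), with H_i a primitive of h_i, is
   convex and coercive, and decreases up to small errors by a_k times the
   dissipation sum_ij pi_i p_ij (h_i(w_i) - h_j(w_j))^2 / 2.  Small dissipation
   and a bounded weighted sum confine w to a bounded set, so V stays bounded
   after a restart at ustar: the truncation levels stabilise. From then on V
   decreases to its minimum on the hyperplane where pi . w is constant, which is
   attained only at the point where all h_i(w_i) coincide. *)

Require Import Defs.
From mathcomp Require Import all_boot all_order all_algebra.
From mathcomp Require Import finmap complex.
From mathcomp Require Import all_classical all_reals all_analysis.
From mathcomp Require Import measurable_realfun.
From mathcomp Require Import ring lra zify.

Set Implicit Arguments.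
Unset Strict Implicit.
Unset Printing Implicit Defensive.

Import Order.TTheory GRing.Theory Num.Theory.
Import numFieldNormedType.Exports.

Local Open Scope classical_set_scope.
Local Open Scope ring_scope.

(** * Series of uncorrelated random variables *)

(** The obstacle is the memory of the agents: [y] approximates the static maps only after a
    transient whose size depends on the past, and the controls keep moving meanwhile. Truncation
    keeps the controls of order ln k, so all signals are O(k^(1/4)) whatever the exponent in the
    growth condition. A geometric transient of that size dies within about sqrt k steps, while over
    such a window the denoised controls move by at most the order of sqrt k * k^(1/4) / k, which
    tends to 0. After a restart there is thus a stretch without usable descent, in which the
    controls stay near [ustar]; descent is available from its end on. The bounds that then confine
    the controls do not depend on the truncation level, so a level that is high enough and reached
    late enough is never exceeded. As the weights may be asymmetric, the left null vector takes over
    the role of symmetry. *)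

Section Uncorrelated.
Context d (T : measurableType d) (R : realType) (P : probability T R).

(** Factorisation on rectangles identifies the joint law with the product of the marginals; Fubini
    then integrates over [X] first, where the inner integral is [y] times a zero mean. *)
Lemma indep_expectationM (X Y : {RV P >-> R}) :
  (forall B C : set R, measurable B -> measurable C ->
     P (X @^-1` B `&` Y @^-1` C) = (P (X @^-1` B) * P (Y @^-1` C))%E) ->
  (X : T -> R) \in Lfun P 2%:E -> (Y : T -> R) \in Lfun P 2%:E ->
  ('E_P[X] = 0)%E -> ('E_P[X \* Y] = 0)%E.
Proof.
move=> indXY lX lY EX0.
have lX1 : (X : T -> R) \in Lfun P 1.
  by apply: Lfun_subset12 => //; rewrite fin_num_measure.
pose XY (w : T) : R * R := (X w, Y w).
have mXY : measurable_fun setT XY.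
  by apply: measurable_fun_pair; exact: measurable_funPT.
pose muX := distribution P X; pose muY := distribution P Y.
have iXY : P.-integrable setT (EFin \o (X \* Y)%R).
  by apply/Lfun1_integrable; exact: Lfun2_mul_Lfun1.
pose XYm : {mfun T >-> (R * R)%type} := mfun_Sub (mem_set mXY).
have eqm A : measurable A -> (muX \x muY)%E A = distribution P XYm A.
  apply: product_measure_unique => B C mB mC.
  exact: indXY.
pose g := (EFin \o (fun z : R * R => z.1 * z.2)).
have mg : measurable_fun [set: (R * R)%type] g.
  by apply/measurable_EFinP; apply: measurable_funM.
have ig : (muX \x muY)%E.-integrable setT g.
  apply/integrableP; split => //.
  rewrite (eq_measure_integral (distribution P XYm)); last first.
    by move=> A mA _; exact: eqm.
  rewrite ge0_integral_distribution//; last exact: measurableT_comp.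
  by have /integrableP[] := iXY.
rewrite unlock.
transitivity (\int[muX \x muY]_z g z)%E.
  rewrite (eq_measure_integral (distribution P XYm)); last first.
    by move=> A mA _; exact: eqm.
  by rewrite integral_distribution.
rewrite -integral21_prod_meas1//.
apply: integral0_eq => y _.
have iX : muX.-integrable setT (EFin : R -> \bar R).
  apply/integrableP; split; first exact/measurable_EFinP.
  rewrite ge0_integral_distribution//; last exact: measurableT_comp.
  by have /Lfun1_integrable/integrableP[] := lX1.
transitivity (\int[muX]_x (x%:E * y%:E))%E; first exact: eq_integral.
rewrite integralZr//.
rewrite integral_distribution//; last exact/Lfun1_integrable.
by move: EX0; rewrite unlock /= => ->; rewrite mul0e.
Qed.

Lemma expectation_sqr_sum (Y : nat -> T -> R) (s : nat -> R) (m n : nat) :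
  (forall k, Y k \in Lfun P 2%:E) ->
  (forall k l, k != l -> ('E_P[Y k \* Y l] = 0)%E) ->
  (forall k, ('E_P[fun w => (Y k w ^+ 2)%R] <= (s k)%:E)%E) ->
  ('E_P[fun w => ((\sum_(m <= k < n) Y k w) ^+ 2)%R]
     <= (\sum_(m <= k < n) s k)%:E)%E.
Proof.
move=> lY uY sY.
have l1 f g : f \in Lfun P 2%:E -> g \in Lfun P 2%:E -> f \* g \in Lfun P 1.
  exact: Lfun2_mul_Lfun1.
have lS k : (fun w => \sum_(m <= j < k) Y j w) \in Lfun P 2%:E.
  rewrite (_ : (fun w => _) = \sum_(m <= j < k) Y j); last first.
    by apply/funext => w; rewrite fct_sumE.
  by rewrite rpred_sum ?lee1n// => j _; exact: lY.
have [nm|mn] := leqP n m.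
  rewrite big_geq//; under [X in expectation P X]funext do rewrite big_geq// expr0n/=.
  by rewrite expectation_cst.
have uS k l : (k <= l)%N -> ('E_P[(fun w => \sum_(m <= j < k) Y j w)%R \* Y l] = 0)%E.
  elim: k => [|k IH] kl.
    rewrite (_ : _ \* _ = cst 0) ?expectation_cst//.
    by apply/funext => w /=; rewrite big_geq// mul0r.
  have [mk|km] := leqP m k; last first.
    rewrite (_ : _ \* _ = cst 0) ?expectation_cst//.
    by apply/funext => w /=; rewrite big_geq// mul0r.
  rewrite (_ : _ \* _ = ((fun w => \sum_(m <= j < k) Y j w) \* Y l) \+ (Y k \* Y l)).
    rewrite expectationD ?l1// IH 1?ltnW// uY ?adde0//.
    by rewrite neq_ltn kl.
  by apply/funext => w /=; rewrite big_nat_recr//= mulrDl.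
elim: n mn => // n IH; rewrite ltnS leq_eqVlt => /predU1P[->|mn].
  by rewrite big_nat1; under [X in expectation P X]funext do rewrite big_nat1.
rewrite big_nat_recr ?(ltnW mn)//= EFinD.
pose S w := \sum_(m <= j < n) Y j w.
rewrite (_ : (fun w => _) = ((S \* S) \+ (2 \o* (S \* Y n))) \+ (Y n \* Y n)); last first.
  by apply/funext => w /=; rewrite big_nat_recr ?(ltnW mn)//= -/(S w); ring.
have lSS : S \in Lfun P 2%:E by exact: lS.
have lSY := l1 _ _ lSS (lY n).
have lZ : 2 \o* (S \* Y n) \in Lfun P 1 by exact: Lfun_scale.
have lSS1 := l1 _ _ lSS lSS; have lYY1 := l1 _ _ (lY n) (lY n).
have lSZ1 : (S \* S) \+ (2 \o* (S \* Y n)) \in Lfun P 1 by rewrite rpredD.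
rewrite (expectationD lSZ1 lYY1) (expectationD lSS1 lZ) (expectationZl _ lSY).
rewrite uS// mule0 adde0.
by apply: leeD; [exact: IH|exact: sY].
Qed.

End Uncorrelated.

Lemma cvg_series_inv_sqr (R : realType) :
  cvgn (series (fun m : nat => (m.+1%:R ^+ 2)^-1 : R)).
Proof.
apply: nondecreasing_is_cvgn.
  by apply: nondecreasing_series => i _ _; rewrite invr_ge0 exprn_ge0.
exists 2 => _ [n _ <-]; case: n => [|n]; first by rewrite /series/= big_geq.
(* The sharper bound 2 - 1/n survives the induction because 1/(n+1)^2 <= 1/n - 1/(n+1). *)
suff : series (fun m : nat => (m.+1%:R ^+ 2)^-1 : R) n.+1 <= 2 - n.+1%:R^-1.
  by move=> /le_trans; apply; rewrite gerBl.
elim: n => [|n IH]; first by rewrite /series/= big_nat1; lra.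
rewrite seriesSr; apply: (le_trans (lerD IH (lexx _))).
have n1 : (0 : R) < n.+1%:R by [].
have n2 : (0 : R) < n.+2%:R by [].
have n2E : n.+2%:R = n.+1%:R + 1 :> R by rewrite -natr1.
have h : (n.+2%:R ^+ 2)^-1 <= n.+1%:R^-1 - n.+2%:R^-1 :> R.
  rewrite -subr_ge0 (_ : _ - _ = (n.+1%:R * n.+2%:R ^+ 2)^-1); last first.
    rewrite n2E in n2 *; field; by rewrite ?lt0r_neq0.
  by rewrite invr_ge0 mulr_ge0// exprn_ge0.
by move: h; move: (n.+1%:R^-1) (n.+2%:R^-1) (_^-1) => a b c; lra.
Qed.

(** Used with cubes for the blocks of the noise series and with squares for the length of a tracking
    window. *)
Lemma power_block (d n : nat) : exists m, (m ^ d.+1 <= n < m.+1 ^ d.+1)%N.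
Proof.
elim: n => [|n [m /andP[mn nm]]]; first by exists 0%N; rewrite exp0n// exp1n.
have [n1|n1] := ltnP n.+1 (m.+1 ^ d.+1); first by exists m; rewrite (leqW mn).
exists m.+1; rewrite n1/=; apply: leq_ltn_trans nm _.
by rewrite ltn_exp2r.
Qed.

(* If the terms of t are uncorrelated with the k-th variance O(1/k^2), cubic
   blocks make the expectation of both summands O(1/m^2). *)
Definition block_energy (R : realType) (t : nat -> R) (m : nat) : R :=
  m.+1%:R ^+ 2 * (series t (m.+1 ^ 3)%N - series t (m ^ 3)%N) ^+ 2 +
  \sum_(m ^ 3 <= n < m.+1 ^ 3) (series t n - series t (m ^ 3)%N) ^+ 2.

(** The first summand of the energy makes the partial sums along cubes converge absolutely, through
    x <= q^(-2) + q^2 x^2; the second bounds every deviation inside a block, and it tends to 0. *)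
Lemma cvg_series_block_energy (R : realType) (t : nat -> R) :
  cvgn (series (block_energy t)) -> cvgn (series t).
Proof.
move=> cG.
pose a m := series t (m ^ 3)%N.
have G0 m : 0 <= block_energy t m.
  apply: addr_ge0; first by rewrite mulr_ge0 ?sqr_ge0.
  by apply: sumr_ge0 => n _; exact: sqr_ge0.
have le1 m : m.+1%:R ^+ 2 * (a m.+1 - a m) ^+ 2 <= block_energy t m.
  by rewrite lerDl sumr_ge0// => n _; exact: sqr_ge0.
have ca : cvgn a.
  suff /cvgP : series (telescope a) @ \oo --> (limn (series (telescope a))).
    rewrite telescopeK => ca.
    rewrite (_ : a = [sequence a n - a 0%N]_n \+ cst (a 0%N)); last first.
      by apply/funext => n /=; rewrite subrK.
    by apply: is_cvgD => //; exact: is_cvg_cst.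
  apply: normed_cvg.
  apply: (@series_le_cvg _ _ ((fun m : nat => (m.+1%:R ^+ 2)^-1) \+ block_energy t)).
  - by move=> n; exact: normr_ge0.
  - by move=> n; rewrite /= addr_ge0// invr_ge0 exprn_ge0.
  - move=> m /=; apply: (@le_trans _ _ ((m.+1%:R ^+ 2)^-1 + m.+1%:R ^+ 2 * (a m.+1 - a m) ^+ 2)).
      rewrite /telescope -(real_normK (num_real (a m.+1 - a m))).
      set x := `|_|.
      have m0 : (0 : R) < m.+1%:R by [].
      set q : R := m.+1%:R in m0 *.
      have q0 : 0 < q^-1 by rewrite invr_gt0.
      rewrite -exprVn -subr_ge0.
      have -> : q^-1 ^+ 2 + q ^+ 2 * x ^+ 2 - x = (q^-1 - q * x) ^+ 2 + x.
        by field; rewrite lt0r_neq0.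
      by rewrite addr_ge0 ?sqr_ge0// normr_ge0.
    by rewrite lerD2l.
  - rewrite (_ : series _ = series (fun m : nat => (m.+1%:R ^+ 2)^-1) \+ series (block_energy t)).
      by apply: is_cvgD => //; exact: cvg_series_inv_sqr.
    by apply/funext => n; rewrite /series/= big_split.
apply/cvg_ex; exists (limn a).
apply/cvgrPdist_lt => e e0.
have e2 : 0 < e / 2 by rewrite divr_gt0.
have := cvg_series_cvg_0 cG.
move=> /cvgrPdist_lt/(_ ((e / 2) ^+ 2)).
rewrite exprn_gt0// => /(_ isT) [m1 _ H1].
move: (ca) => /cvgrPdist_lt/(_ _ e2) [m2 _ H2].
exists ((maxn m1 m2) ^ 3)%N => //= n nm.
have [m /andP[mn nm']] := power_block 2 n.
have mm : (maxn m1 m2 <= m)%N.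
  have : ((maxn m1 m2) ^ 3 < m.+1 ^ 3)%N by exact: leq_ltn_trans nm nm'.
  by rewrite ltn_exp2r.
have {}H1 := H1 m (leq_trans (leq_maxl _ _) mm).
have {}H2 := H2 m (leq_trans (leq_maxr _ _) mm).
rewrite /= sub0r normrN ger0_norm// in H1.
have : (series t n - a m) ^+ 2 < (e / 2) ^+ 2.
  apply: le_lt_trans H1; rewrite /block_energy.
  rewrite (@big_cat_nat _ _ _ n)//= 1?ltnW// (@big_ltn _ _ _ n)//.
  apply: ler_wpDl; first by rewrite mulr_ge0 ?sqr_ge0.
  apply: ler_wpDl; first by rewrite sumr_ge0// => k _; exact: sqr_ge0.
  by rewrite lerDl sumr_ge0// => k _; exact: sqr_ge0.
rewrite -ltr_sqrt ?exprn_gt0// !sqrtr_sqr (gtr0_norm e2) => H3.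
rewrite (_ : _ - _ = (limn a - a m) - (series t n - a m)); last by ring.
by apply: (le_lt_trans (ler_normB _ _)); move: H2 H3; lra.
Qed.

(** * Almost sure convergence of random series with weights 1/k *)

Section StrongLaw.
Context d (T : measurableType d) (R : realType) (P : probability T R).

(** The block energies have summable expectations, so their sum has finite expectation and is finite
    almost surely; the rest is deterministic. *)
Lemma uncorrelated_series_cvg (X : nat -> T -> R) (C : R) :
  (forall k, X k \in Lfun P 2%:E) ->
  (forall k l, k != l -> ('E_P[X k \* X l] = 0)%E) ->
  (forall k, ('E_P[fun w => (X k w ^+ 2)%R] <= C%:E)%E) ->
  {ae P, forall w, cvgn (series (fun k => X k w / k.+1%:R))}.
Proof.
move=> lX uX XC.
have C0 : 0 <= C.
  by rewrite -lee_fin; apply: le_trans (XC 0%N); apply: expectation_ge0 => w; exact: sqr_ge0.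
pose Y k w := X k w / k.+1%:R.
have lY k : Y k \in Lfun P 2%:E.
  by apply: Lfun_scale; [rewrite ler1n|exact: lX].
have lXX k l : X k \* X l \in Lfun P 1 by exact: Lfun2_mul_Lfun1.
have uY k l : k != l -> ('E_P[Y k \* Y l] = 0)%E.
  move=> kl; rewrite (_ : _ \* _ = (k.+1%:R^-1 * l.+1%:R^-1) \o* (X k \* X l)).
    by rewrite expectationZl// uX// mule0.
  by apply/funext => w; rewrite /Y /=; ring.
pose s k := C * (k.+1%:R ^+ 2)^-1.
have sY k : ('E_P[fun w => (Y k w ^+ 2)%R] <= (s k)%:E)%E.
  rewrite (_ : (fun w => _) = ((k.+1%:R ^+ 2)^-1) \o* (X k \* X k)).
    rewrite expectationZl// /s mulrC EFinM lee_pmul2l ?lte_fin ?invr_gt0 ?exprn_gt0//.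
    exact: XC.
  by apply/funext => w; rewrite /Y /= exprMn exprVn; ring.
have mY k : measurable_fun setT (Y k).
  by have /andP[] := lY k; rewrite inE.
pose S n w := series (Y ^~ w) n.
have mS n : measurable_fun setT (S n).
  by apply: measurable_sum => k; exact: mY.
(* A block has at most 3 (m+1)^2 terms, each of variance at most C / (m^3+1)^2 <= 16 C / (m+1)^6,
   since (m+1)^3 <= 4 (m^3+1); hence 48 = 3 * 16. *)
pose b m : R := C * 48 / m.+1%:R ^+ 4.
have bP m n : (m ^ 3 <= n <= m.+1 ^ 3)%N ->
    ('E_P[fun w => ((S n w - S (m ^ 3)%N w) ^+ 2)%R] <= (b m)%:E)%E.
  move=> /andP[mn nm].
  rewrite (_ : (fun w => _) = (fun w => (\sum_(m ^ 3 <= k < n) Y k w) ^+ 2)); last first.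
    apply/funext => w; rewrite /S /series/= (big_cat_nat _ (n := m ^ 3))//=.
    by rewrite addrAC subrr add0r.
  apply: le_trans (expectation_sqr_sum _ _ lY uY sY) _.
  rewrite lee_fin.
  apply: (@le_trans _ _ (\sum_(m ^ 3 <= k < m.+1 ^ 3) C * ((m ^ 3).+1%:R ^+ 2)^-1)).
    apply: (@le_trans _ _ (\sum_(m ^ 3 <= k < n) C * ((m ^ 3).+1%:R ^+ 2)^-1)).
      apply: ler_sum_nat => k /andP[mk _]; rewrite /s ler_wpM2l//.
      by rewrite lef_pV2 ?posrE ?exprn_gt0// ler_pXn2r ?nnegrE// ler_nat ltnS.
    rewrite [leRHS](big_cat_nat _ (n := n))//=.
    rewrite lerDl sumr_ge0// => k _.
    by rewrite mulr_ge0// invr_ge0 exprn_ge0.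
  rewrite sumr_const_nat -mulrnAr /b -mulrA ler_wpM2l//.
  rewrite -mulr_natl natrB ?leq_exp2r// -[(m ^ 3).+1%:R]natr1 !natrX -[m.+1%:R]natr1.
  set x : R := m%:R; have x0 : 0 <= x by [].
  have X0 : 0 < x ^+ 3 + 1 by rewrite ltr_wpDl// exprn_ge0.
  have h1 : (x + 1) ^+ 3 <= 4 * (x ^+ 3 + 1).
    rewrite -subr_ge0 (_ : _ - _ = 3 * ((x - 1) ^+ 2 * (x + 1))); last by ring.
    by rewrite mulr_ge0// mulr_ge0 ?sqr_ge0// addr_ge0.
  have h2 : ((x + 1) ^+ 3) ^+ 2 <= (4 * (x ^+ 3 + 1)) ^+ 2.
    have x1 : 0 <= x + 1 by rewrite addr_ge0.
    by rewrite ler_sqr// nnegrE ?exprn_ge0// mulr_ge0// ltW.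
  rewrite ler_pdivrMr ?exprn_gt0// [leRHS]mulrAC ler_pdivlMr ?exprn_gt0 ?ltr_wpDl//.
  apply: (@le_trans _ _ (3 * (x + 1) ^+ 2 * (x + 1) ^+ 4)).
    rewrite ler_wpM2r ?exprn_ge0 ?addr_ge0// -subr_ge0.
    by rewrite (_ : _ - _ = 3 * x + 2) ?addr_ge0 ?mulr_ge0//; ring.
  rewrite (_ : 3 * _ * _ = 3 * ((x + 1) ^+ 3) ^+ 2); last by ring.
  rewrite (_ : 48 * _ = 3 * (4 * (x ^+ 3 + 1)) ^+ 2); last by ring.
  by rewrite ler_wpM2l.
have mD m n : measurable_fun setT (fun w => (S n w - S m w) ^+ 2).
  by apply: measurable_funX; exact: measurable_funB.
have mG m : measurable_fun setT (fun w => block_energy (Y ^~ w) m).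
  apply: measurable_funD; first by apply: measurable_funM => //; exact: mD.
  by apply: measurable_sum => n; exact: mD.
have G0 m w : 0 <= block_energy (Y ^~ w) m.
  apply: addr_ge0; first by rewrite mulr_ge0 ?sqr_ge0.
  by apply: sumr_ge0 => n _; exact: sqr_ge0.
(* The weight (m+1)^2 and the at most 3 (m+1)^2 inner squares add up to 4 (m+1)^2 copies of [b m];
   hence 192 = 4 * 48. *)
have EG m : (\int[P]_w (block_energy (Y ^~ w) m)%:E
             <= (192 * C * (m.+1%:R ^+ 2)^-1)%:E)%E.
  rewrite /block_energy.
  under eq_integral do rewrite EFinD EFinM -sumEFin.
  rewrite ge0_integralD//=; last 4 first.
  - by move=> w _; rewrite -EFinM lee_fin mulr_ge0 ?sqr_ge0.
  - by apply/measurable_EFinP; apply: measurable_funM => //; exact: mD.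
  - by move=> w _; rewrite sume_ge0// => n _; rewrite lee_fin sqr_ge0.
  - by apply: emeasurable_sum => n; apply/measurable_EFinP; exact: mD.
  rewrite ge0_integralZl_EFin ?sqr_ge0//; last 2 first.
  - by move=> w _; rewrite lee_fin sqr_ge0.
  - by apply/measurable_EFinP; exact: mD.
  rewrite ge0_integral_sum//; last 2 first.
  - by move=> n; apply/measurable_EFinP; exact: mD.
  - by move=> n w _; rewrite lee_fin sqr_ge0.
  have {}bP n : (m ^ 3 <= n <= m.+1 ^ 3)%N ->
      (\int[P]_w ((series (Y ^~ w) n - series (Y ^~ w) (m ^ 3)%N) ^+ 2)%:E <= (b m)%:E)%E.
    by move=> /bP; rewrite unlock.
  apply: (@le_trans _ _ ((m.+1%:R ^+ 2)%:E * (b m)%:E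
      + \sum_(m ^ 3 <= n < m.+1 ^ 3) (b m)%:E)%E).
    apply: leeD.
      by rewrite lee_pmul2l ?lte_fin ?exprn_gt0// bP// leqnn andbT leq_exp2r.
    rewrite big_nat [leRHS]big_nat; apply: lee_sum => n /andP[mn nm].
    by rewrite bP// mn ltnW.
  rewrite sumEFin sumr_const_nat -EFinM -EFinD lee_fin.
  rewrite -[X in _ + X]mulr_natl -mulrDl natrB ?leq_exp2r// !natrX /b -[m.+1%:R]natr1.
  set x : R := m%:R; have x0 : 0 <= x by [].
  have x1 : 0 < x + 1 by rewrite ltr_wpDl.
  apply: (@le_trans _ _ (4 * (x + 1) ^+ 2 * (C * 48 / (x + 1) ^+ 4))).
    rewrite ler_wpM2r ?mulr_ge0 ?invr_ge0 ?exprn_ge0 ?(ltW x1)// -subr_ge0.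
    by rewrite (_ : _ - _ = 3 * x + 2) ?addr_ge0 ?mulr_ge0//; ring.
  by rewrite le_eqVlt; apply/orP; left; apply/eqP; field; rewrite lt0r_neq0.
have intG : P.-integrable setT (fun w => \sum_(m <oo) (block_energy (Y ^~ w) m)%:E)%E.
  apply/integrableP; split.
    apply: ge0_emeasurable_sum => [k w _ _|k _]; first by rewrite lee_fin.
    exact/measurable_EFinP.
  under eq_integral.
    move=> w _; rewrite gee0_abs; last first.
      by apply: nneseries_ge0 => m _ _; rewrite lee_fin.
    over.
  rewrite integral_nneseries//; last 2 first.
    by move=> m; exact/measurable_EFinP.
    by move=> m w _; rewrite lee_fin.
  apply: (@le_lt_trans _ _ (\sum_(m <oo) (192 * C * (m.+1%:R ^+ 2)^-1)%:E)%E).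
    apply: lee_nneseries => [m _ *|m _ *]; last exact: EG.
    by apply: integral_ge0 => w _; rewrite lee_fin.
  pose q : nat -> R := fun m => (m.+1%:R ^+ 2)^-1.
  rewrite (_ : (fun n => _) = EFin \o (cst (192 * C) \* series q)); last first.
    by apply/funext => n /=; rewrite sumEFin /series/= -mulr_sumr.
  rewrite EFin_lim ?ltry//; apply: is_cvgM; first exact: is_cvg_cst.
  exact: cvg_series_inv_sqr.
have := integrable_ae measurableT intG.
apply: filterS => w /(_ I) fin.
apply: cvg_series_block_energy.
apply: nondecreasing_is_cvgn.
  by apply: nondecreasing_series => m _ _; exact: G0.
exists (fine (\sum_(m <oo) (block_energy (Y ^~ w) m)%:E)%E) => _ [n _ <-].
rewrite -lee_fin fineK// /series/= -sumEFin.
apply: nneseries_lim_ge => k _ *; rewrite lee_fin; exact: G0.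
Qed.
End StrongLaw.

(** * Convex primitives and uniform continuity *)

Section ConvexPrimitive.
Context (R : realType).
Local Notation mu := (@lebesgue_measure R).

(** The inequality says that [h b] is a subgradient of the primitive at [b]; it is the only property
    of [H] on which the Lyapunov argument rests. *)
Lemma continuous_nondecreasing_primitive (h : R -> R) :
  continuous h -> {homo h : x y / x <= y} ->
  exists H : R -> R, forall a b, H b - H a <= h b * (b - a).
Proof.
move=> ch mh.
have itg a b : mu.-integrable `[a, b] (EFin \o h).
  apply: continuous_compact_integrable; first exact: segment_compact.
  exact: continuous_subspaceT.
pose I a b : R := \int[mu]_(t in `[a, b]) h t.
have chasles a c b : a <= c -> c <= b -> I a b = I a c + I c b.
  move=> ac cb.
  have := @Rintegral_itvB R h (BLeft a) (BRight b) c (itg a b).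
  rewrite !bnd_simp => /(_ ac cb) E.
  rewrite /I addrC; apply/eqP; rewrite -subr_eq; apply/eqP.
  rewrite E Rintegral_itv_obnd_cbnd//.
  by apply: integrableS (itg c b) => //; apply: subset_itvr; rewrite bnd_simp.
have icst0 a b r : a <= b -> \int[mu]_(t in `[a, b]) (cst r) t = r * (b - a).
  move=> ab; rewrite Rintegral_cst//.
  have E := lebesgue_measure_itv `[a, b]; rewrite /= lte_fin in E.
  congr (_ * _); transitivity (fine (if (a < b)%R then b%:E - a%:E else 0)%E).
    by congr fine; exact: E.
  by move: ab; rewrite le_eqVlt => /predU1P[->|->//]; rewrite ltxx subrr.
have icst a b r : mu.-integrable `[a, b] (EFin \o cst r).
  apply: continuous_compact_integrable; first exact: segment_compact.
  by apply: continuous_subspaceT => x; exact: cvg_cst.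
have Ile a b : a <= b -> I a b <= h b * (b - a).
  move=> ab; rewrite -icst0//; apply: le_Rintegral => // x /=.
  by rewrite in_itv/= => /andP[_]; exact: mh.
have Ige a b : a <= b -> h a * (b - a) <= I a b.
  move=> ab; rewrite -icst0//; apply: le_Rintegral => // x /=.
  by rewrite in_itv/= => /andP[+ _]; exact: mh.
(* The lower endpoint lies below both [x] and 0, so no integral is reversed; lowering it further
   changes nothing, which lets two values be compared from a common endpoint. *)
pose H x := I (- (`|x| + 1)) x - I (- (`|x| + 1)) 0.
have HE0 x b c : 0 <= b -> b <= c -> `|x| <= b ->
    I (- c) x - I (- c) 0 = I (- b) x - I (- b) 0.
  move=> b0 bc; rewrite ler_norml => /andP[bx xb].
  rewrite (@chasles (- c) (- b) x) ?lerN2// (@chasles (- c) (- b) 0) ?lerN2 ?oppr_le0//.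
  by rewrite opprD addrACA subrr add0r.
have HE x c : `|x| + 1 <= c -> H x = I (- c) x - I (- c) 0.
  by move=> xc; rewrite (@HE0 x (`|x| + 1) c) ?addr_ge0 ?lerDl.
exists H => a b.
have ac : `|a| + 1 <= `|a| + `|b| + 1 by rewrite lerD2r lerDl.
have bc : `|b| + 1 <= `|a| + `|b| + 1 by rewrite lerD2r lerDr.
set c := `|a| + `|b| + 1 in ac bc.
rewrite (HE _ _ ac) (HE _ _ bc) opprB addrA subrK.
have ac' : - c <= a.
  by have := ler_norm (- a); rewrite normrN; move: ac; lra.
have bc' : - c <= b.
  by have := ler_norm (- b); rewrite normrN; move: bc; lra.
have [ab|/ltW ba] := leP a b.
  by rewrite (@chasles (- c) a b)// addrAC subrr add0r Ile.
rewrite (@chasles (- c) b a)//.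
by have := Ige _ _ ba; lra.
Qed.

(** Only [x] is confined to the segment: [y] is quantified inside the predicate to which compactness
    is applied, so a perturbed point may leave the segment. *)
Lemma continuous_unif_segment (f : R -> R) (B e : R) :
  continuous f -> 0 < e ->
  exists2 dl, 0 < dl & forall x y, `|x| <= B -> `|x - y| <= dl -> `|f x - f y| <= e.
Proof.
move=> cf e0.
have /compact_near_coveringP/(_ R (0^'+)
  (fun dl x => forall y, `|x - y| <= dl -> `|f x - f y| <= e)) := @segment_compact R (- B) B.
move=> /(_ _)[|dl /= dl0 Hdl].
  move=> x _.
  have /cvgrPdist_le/(_ (e / 2)) := cf x.
  rewrite divr_gt0// => /(_ isT) [r /= r0 Hr].
  exists (ball x (r / 2), [set t | t < r / 2]).
    split => /=; first by apply: nbhsx_ballx; rewrite divr_gt0.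
    by apply: nbhs_right_lt; rewrite divr_gt0.
  move=> [x' t] /= [xx' tr] y x'y.
  have h1 : `|f x - f x'| <= e / 2.
    by apply: Hr => /=; move: xx'; rewrite /ball/=; lra.
  have h2 : `|f x - f y| <= e / 2.
    apply: Hr => /=; move: xx'; rewrite /ball/= => xx'.
    rewrite (_ : x - y = (x - x') + (x' - y)); last by ring.
    by apply: le_lt_trans (ler_normD _ _) _; lra.
  rewrite (_ : f x' - f y = (f x - f y) - (f x - f x')); last by ring.
  by apply: le_trans (ler_normB _ _) _; lra.
exists (dl / 2); first by rewrite divr_gt0.
move=> x y xB xy; apply: (Hdl (dl / 2)) => //=.
- by rewrite sub0r normrN gtr0_norm ?divr_gt0// ltr_pdivrMr// ltr_pMr// ltr1n.
- by rewrite divr_gt0.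
- by rewrite in_itv/= -ler_norml.
Qed.

End ConvexPrimitive.

(** * The weighted graph Laplacian *)

Lemma pos_lower_bound (R : realFieldType) (I : finType) (f : I -> R) :
  (forall i, 0 < f i) -> exists2 m, 0 < m & forall i, m <= f i.
Proof.
move=> f0.
have S0 : 0 <= \sum_i (f i)^-1 by apply: sumr_ge0 => i _; rewrite invr_ge0 ltW.
have S1 : 0 < 1 + \sum_i (f i)^-1 by rewrite ltr_pwDl.
(* Unlike a minimum, this witness is meaningful and positive for an empty index type as well. *)
exists (1 + \sum_i (f i)^-1)^-1; first by rewrite invr_gt0.
move=> i; rewrite -[leRHS]invrK lef_pV2 ?posrE ?invr_gt0//.
rewrite (bigD1 i)//= addrCA lerDl addr_ge0// sumr_ge0// => j _.
by rewrite invr_ge0 ltW.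
Qed.

Lemma upper_bound_fin (R : realFieldType) (I : finType) (f : I -> R) :
  exists2 m, 0 <= m & forall i, f i <= m.
Proof.
exists (\sum_i `|f i|); first by rewrite sumr_ge0.
move=> i; rewrite (bigD1 i)//=; apply: le_trans (ler_norm _) _.
by rewrite lerDl sumr_ge0.
Qed.

Section Laplacian.
Context (R : realType) (N : nat) (p : 'M[R]_N) (e : rel 'I_N).
Hypotheses (p_adj : adjacency_matrix e p) (e_sym : symmetric e)
  (e_conn : connected_graph e).

Definition laplacian (b : 'I_N -> R) (i : 'I_N) : R :=
  \sum_j p i j * (b i - b j).

Lemma adj_ge0 i j : 0 <= p i j.
Proof.
have [pe pne] := p_adj i j.
by have [/pe/ltW//|/pne->//] := boolP (e j i).
Qed.

Lemma closed_connected (a : {pred 'I_N}) (i0 : 'I_N) :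
  (forall i j, e i j -> i \in a -> j \in a) -> i0 \in a -> forall i, i \in a.
Proof.
move=> ea ai0 i.
have ca : fingraph.closed e a.
  apply: intro_closed; last exact: ea.
  exact: sym_connect_sym.
by rewrite -(closed_connect ca (e_conn i0 i)).
Qed.

(** A Perron-Frobenius argument: zero row sums make the Laplacian singular, hence it has a left null
    vector, and the absolute values of its entries turn out to be positive by connectedness. *)
Lemma left_null_weights (i0 : 'I_N) :
  exists2 pi : 'I_N -> R, forall i, 0 < pi i &
    forall b, \sum_i pi i * laplacian b i = 0.
Proof.
pose dg i := \sum_k p i k.
pose L := \matrix_(i, j) ((i == j)%:R * dg i - p i j).
have detL : \det L = 0.
  rewrite -det_tr; apply/eqP/det0P; exists (const_mx 1).
    by apply/eqP => /rowP/(_ i0); rewrite !mxE; apply/eqP; exact: oner_neq0.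
  apply/rowP => i; rewrite !mxE.
  under eq_bigr do rewrite !mxE mul1r.
  rewrite sumrB (bigD1 i)//= eqxx mul1r big1 ?addr0 ?subrr// => j /negPf ji.
  by rewrite eq_sym ji mul0r.
have /det0P[v v0 vL] : \det L == 0 by apply/eqP.
have vE j : \sum_i v 0 i * p i j = v 0 j * dg j.
  have /rowP/(_ j) := vL; rewrite !mxE.
  under eq_bigr do rewrite !mxE mulrBr.
  rewrite sumrB => /eqP; rewrite subr_eq0 => /eqP <-.
  rewrite (bigD1 j)//= eqxx mul1r big1 ?addr0// => i /negPf ij.
  by rewrite ij mul0r mulr0.
(* The absolute values form a null vector too: the triangle inequality gives
   one inequality per column, and the column sums force equality. *)
pose x i := `|v 0 i|.
have xle j : 0 <= \sum_i x i * p i j - x j * dg j.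
  rewrite subr_ge0.
  have dg0 : 0 <= dg j by apply: sumr_ge0 => k _; exact: adj_ge0.
  rewrite -[dg j]ger0_norm// -normrM -vE.
  apply: le_trans (ler_norm_sum _ _ _) _; apply: ler_sum => i _.
  by rewrite normrM (ger0_norm (adj_ge0 _ _)).
have xE j : \sum_i x i * p i j = x j * dg j.
  have sum0 : \sum_j (\sum_i x i * p i j - x j * dg j) = 0.
    rewrite sumrB exchange_big/= -sumrB big1// => i _.
    by rewrite -mulr_sumr subrr.
  have := psumr_eq0P (fun i _ => xle i) sum0.
  by move=> /(_ j isT) /eqP; rewrite subr_eq0 => /eqP.
(* A vanishing entry propagates: its column equation is a zero sum of nonnegative terms, so every
   neighbour vanishes too, and then the whole vector. *)
have xpos i : 0 < x i.
  rewrite lt_neqAle normr_ge0 andbT eq_sym; apply/negP => /eqP xi0.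
  move/negP: v0; apply; apply/eqP/rowP => j; rewrite mxE.
  suff : j \in [pred k | x k == 0] by rewrite inE normr_eq0 => /eqP.
  apply: (@closed_connected _ i); last by rewrite inE xi0.
  move=> k l kl; rewrite !inE => /eqP xk0.
  have S0 : \sum_i x i * p i k = 0 by rewrite xE xk0 mul0r.
  have := psumr_eq0P _ S0 => /(_ (fun i _ => mulr_ge0 (normr_ge0 _) (adj_ge0 _ _)) l isT).
  move/eqP; rewrite mulf_eq0 => /orP[//|/eqP plk].
  by have [/(_ kl)] := p_adj l k; rewrite plk ltxx.
exists x => // b; rewrite /laplacian.
under eq_bigr do rewrite mulr_sumr.
under eq_bigr => i _ do under eq_bigr => j _ do rewrite mulrA mulrBr.
under eq_bigr do rewrite sumrB.
rewrite sumrB [X in _ - X]exchange_big/= -sumrB big1// => i _.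
by rewrite -!mulr_suml xE -mulr_sumr subrr.
Qed.

Context (pi : 'I_N -> R).
Hypotheses (pi_gt0 : forall i, 0 < pi i)
  (pi_null : forall b, \sum_i pi i * laplacian b i = 0).

Definition energy (z : 'I_N -> R) : R := \sum_i pi i * (z i * laplacian z i).

(** Half of the Laplacian of the squares can be subtracted at no cost because [pi] annihilates it;
    then z_i (z_i - z_j) - (z_i^2 - z_j^2) / 2 = (z_i - z_j)^2 / 2 term by term. Symmetry of [p] is
    not involved. *)
Lemma energyE z :
  energy z = 2^-1 * \sum_i \sum_j pi i * p i j * (z i - z j) ^+ 2.
Proof.
rewrite /energy; apply/eqP; rewrite -subr_eq0; apply/eqP.
transitivity (2^-1 * \sum_i pi i * laplacian (fun i => z i ^+ 2) i); last first.
  by rewrite pi_null mulr0.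
rewrite !mulr_sumr -sumrB; apply: eq_bigr => i _.
rewrite /laplacian !mulr_sumr -sumrB; apply: eq_bigr => j _.
by field.
Qed.

Lemma energy_ge0 z : 0 <= energy z.
Proof.
rewrite energyE mulr_ge0 ?invr_ge0// sumr_ge0// => i _; apply: sumr_ge0 => j _.
by rewrite mulr_ge0 ?sqr_ge0// mulr_ge0 ?adj_ge0// ltW.
Qed.

Lemma energy_ge_edge z i j : e j i -> 2^-1 * (pi i * p i j * (z i - z j) ^+ 2) <= energy z.
Proof.
move=> eji; rewrite energyE ler_wpM2l ?invr_ge0//.
have t0 k l : 0 <= pi k * p k l * (z k - z l) ^+ 2.
  by rewrite mulr_ge0 ?sqr_ge0// mulr_ge0 ?adj_ge0// ltW.
rewrite (bigD1 i)//= (bigD1 j)//= -addrA lerDl addr_ge0// sumr_ge0// => k _.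
by apply: sumr_ge0.
Qed.

(** Along a path the tolerance is halved at each edge, and the energy dominates each edge term
    separately; finitely many pairs share a positive threshold. *)
Lemma energy_spread (dl : R) : 0 < dl ->
  exists2 eta, 0 < eta & forall z, energy z <= eta -> forall i j, `|z i - z j| <= dl.
Proof.
move=> dl0.
have pair (i j : 'I_N) : exists eta, 0 < eta /\ forall z, energy z <= eta -> `|z i - z j| <= dl.
  have /connectP[s] := e_conn i j.
  elim: s i dl dl0 => [|k s IH] i dl dl0 /=.
    by move=> _ ->; exists 1; split => // z _; rewrite subrr normr0 ltW.
  move=> /andP[eik ps] jE.
  have dl2 : 0 < dl / 2 by rewrite divr_gt0.
  have [eta [eta0 Heta]] := IH k _ dl2 ps jE.
  have pki : 0 < p k i by have [/(_ eik)] := p_adj k i.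
  have c0 : 0 < 2^-1 * (pi k * p k i) by rewrite !mulr_gt0// invr_gt0.
  exists (Num.min eta (2^-1 * (pi k * p k i) * (dl / 2) ^+ 2)).
  rewrite lt_min eta0/= mulr_gt0 ?exprn_gt0//; split=> // z.
  rewrite le_min => /andP[/Heta h1 h2].
  have := le_trans (energy_ge_edge z eik) h2.
  rewrite mulrA ler_pM2l// -ler_sqrt ?exprn_ge0 ?(ltW dl2)// !sqrtr_sqr.
  rewrite (gtr0_norm dl2) => h3.
  rewrite (_ : z i - z j = (z k - z j) - (z k - z i)); last by ring.
  by apply: le_trans (ler_normB _ _) _; lra.
pose f (ij : 'I_N * 'I_N) : R := projT1 (cid (pair ij.1 ij.2)).
have f0 ij : 0 < f ij by rewrite /f; case: cid => /= ? [].
have [m m0 mf] := pos_lower_bound f0.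
exists m => // z zm i j.
have := mf (i, j); rewrite /f; case: cid => /= eta [_ Heta] meta.
by apply: Heta; exact: le_trans meta.
Qed.

Lemma laplacian_form_bound : exists2 c, 0 <= c & forall a b (x y : R), 0 <= x -> 0 <= y ->
  (forall i, `|a i| <= x) -> (forall i, `|b i| <= y) ->
  `|\sum_i pi i * (a i * laplacian b i)| <= c * (x * y).
Proof.
exists (\sum_i \sum_j pi i * p i j * 2).
  apply: sumr_ge0 => i _; apply: sumr_ge0 => j _.
  by rewrite mulr_ge0// mulr_ge0 ?adj_ge0// ltW.
move=> a b x y x0 y0 ax bb.
apply: le_trans (ler_norm_sum _ _ _) _; rewrite mulr_suml; apply: ler_sum => i _.
rewrite /laplacian !mulr_sumr mulr_suml.
apply: le_trans (ler_norm_sum _ _ _) _; apply: ler_sum => j _.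
rewrite !normrM (gtr0_norm (pi_gt0 _)) (ger0_norm (adj_ge0 _ _)).
have pp0 : 0 <= pi i * p i j by rewrite mulr_ge0 ?adj_ge0// ltW.
set A := `|a i|; set B := `|b i - b j|.
apply: (@le_trans _ _ (pi i * p i j * (A * B))).
  by rewrite le_eqVlt; apply/orP; left; apply/eqP; ring.
rewrite -[leRHS]mulrA.
have By : B <= 2 * y.
  apply: le_trans (ler_normB _ _) _.
  by have := bb i; have := bb j; lra.
by rewrite ler_wpM2l// mulrCA; apply: ler_pM; rewrite ?normr_ge0 ?ax.
Qed.

Lemma laplacian_bound : exists2 c, 0 <= c & forall b (y : R), 0 <= y ->
  (forall i, `|b i| <= y) -> forall i, `|laplacian b i| <= c * y.
Proof.
exists (\sum_i \sum_j p i j * 2).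
  apply: sumr_ge0 => i _; apply: sumr_ge0 => j _.
  by rewrite mulr_ge0// adj_ge0.
move=> b y y0 bb i.
apply: (@le_trans _ _ (\sum_j p i j * 2 * y)).
  apply: le_trans (ler_norm_sum _ _ _) _; apply: ler_sum => j _.
  rewrite normrM (ger0_norm (adj_ge0 _ _)) -mulrA ler_wpM2l ?adj_ge0//.
  apply: le_trans (ler_normB _ _) _.
  by have := bb i; have := bb j; lra.
rewrite -mulr_suml ler_wpM2r// [leRHS](bigD1 i)//= lerDl sumr_ge0// => k _.
by apply: sumr_ge0 => j _; rewrite mulr_ge0// adj_ge0.
Qed.

End Laplacian.

(** * Stable linear filters *)

Lemma intz_addr0 (k : int) : k + 0%N%:Z = k. Proof. exact: addr0. Qed.
Lemma intz_subr0 (k : int) : k - 0%N%:Z = k. Proof. exact: subr0. Qed.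
Lemma intz_subS (k : int) (s : nat) : k - s.+1%:Z = k - s%:Z - 1. Proof. lia. Qed.
Lemma intz_addSK (k : int) (s : nat) : k + s.+1%:Z - 1 = k + s%:Z. Proof. lia. Qed.

Section Filter.
Context (R : realType).
Local Notation normc := (@ComplexField.Normc.normc R).

(** [shift_apply] over a general ring, because the characteristic polynomial is factored over the
    complex numbers. *)
Definition poly_shift (F : comNzRingType) (C : {poly F}) (x : int -> F) (k : int) : F :=
  \sum_(s < size C) C`_s * x (k - s%:Z).

Lemma poly_shift_widen (F : comNzRingType) (C : {poly F}) n x k : (size C <= n)%N ->
  poly_shift C x k = \sum_(s < n) C`_s * x (k - s%:Z).
Proof.
move=> Cn; rewrite /poly_shift.
rewrite -(big_mkord xpredT (fun s : nat => C`_s * x (k - s%:Z))).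
rewrite -(big_mkord xpredT (fun s : nat => C`_s * x (k - s%:Z))).
rewrite [RHS](big_cat_nat _ (n := size C))//= [X in _ = _ + X]big_nat [X in _ = _ + X]big1 ?addr0//.
by move=> s /andP[Cs _]; rewrite nth_default// mul0r.
Qed.

Lemma poly_shift1 (F : comNzRingType) (x : int -> F) k : poly_shift 1 x k = x k.
Proof.
by rewrite /poly_shift size_poly1 big_ord1 coefC eqxx mul1r subr0.
Qed.

Lemma poly_shift_factor (F : comNzRingType) (C : {poly F}) (r : F) x k :
  poly_shift ((1 - r *: 'X) * C) x k = poly_shift C x k - r * poly_shift C x (k - 1).
Proof.
rewrite (@poly_shift_widen _ _ (size C).+1); last first.
  apply: leq_trans (size_polyMleq _ _) _.
  have : (size (1 - r *: 'X : {poly F})%R <= 2)%N.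
    rewrite (leq_trans (size_polyD _ _))// size_polyN geq_max size_poly1/=.
    by rewrite (leq_trans (size_scale_leq _ _))// size_polyX.
  lia.
rewrite (@poly_shift_widen _ C (size C).+1 x k)//.
rewrite [poly_shift C x (k - 1)]/poly_shift.
under eq_bigr => s _.
  rewrite mulrBl mul1r coefB -scalerAl coefZ coefXM mulrBl; over.
rewrite sumrB; congr (_ - _).
rewrite big_ord_recl/= mulr0 mul0r add0r mulr_sumr.
apply: eq_bigr => s _; rewrite /bump/= mulrA; congr (_ * x _).
by rewrite -addrA -opprD -PoszD.
Qed.

(** The factors are peeled off one by one: x_k - r x_(k-1) is filtered by the remaining ones, and
    [x] is recovered from it by a first-order recursion. The bound separates the forgotten initial
    window ([G]) from the persistent forcing ([dl]). *)
Lemma factor_filter_bound (rs : seq R[i]) :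
  all (fun r => normc r < 1) rs ->
  exists K lam : R, [/\ 0 <= K, 0 < lam < 1 &
    forall (x : int -> R[i]) (k0 : int) (G dl : R) (n : nat), 0 <= G -> 0 <= dl ->
      (forall s : nat, (s <= size rs)%N -> normc (x (k0 - s%:Z)) <= G) ->
      (forall j : nat, (j < n)%N ->
        normc (poly_shift (\prod_(r <- rs) (1 - r *: 'X)) x (k0 + j.+1%:Z)) <= dl) ->
      normc (x (k0 + n%:Z)) <= K * (lam ^+ n * G + dl)].
Proof.
have nD := @le_normcD R; have nM := @ComplexField.Normc.normcM R.
have nN := @normcN R.
have n0 (z : R[i]) : 0 <= normc z by case: z => a b; exact: sqrtr_ge0.
elim: rs => [|r rs IH] /=.
  move=> _; exists 1, 2^-1; split => //.
    by lra.
  move=> x k0 G dl n G0 dl0 h1 h2; rewrite mul1r.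
  case: n h2 => [_|n h2].
    by have := h1 0%N isT; rewrite intz_subr0 ?intz_addr0 expr0 mul1r; lra.
  have := h2 n (ltnSn _); rewrite big_nil poly_shift1 => /le_trans; apply.
  by rewrite lerDr mulr_ge0// exprn_ge0// invr_ge0.
move=> /andP[r1 /IH [K [lam [K0 /andP[lam0 lam1] H]]]] {IH}.
set a := normc r in r1; have a0 : 0 <= a := n0 r.
(* 1 - mu is half the product of the gaps 1 - lam and 1 - a, so [mu] lies strictly above both rates;
   the room above [a] is what makes [c1] finite. *)
pose mu := 1 - (1 - lam) * (1 - a) / 2.
have mu1 : mu < 1 by rewrite /mu; nra.
have lmu : lam < mu by rewrite /mu; nra.
have amu : a < mu by rewrite /mu; nra.
have mu0 : 0 < mu by lra.
(* [c1] and [c2] close the induction for the transient and for the forced part separately. *)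
have [c1 c11 c1P] : exists2 c1, 1 <= c1 & (c1 * a + 2 * K <= c1 * mu).
  exists (1 + 2 * K / (mu - a)).
    by rewrite lerDl divr_ge0 ?mulr_ge0 ?subr_ge0// ltW.
  have : 2 * K / (mu - a) * (mu - a) = 2 * K by rewrite divfK// subr_eq0 gt_eqF.
  by move: (_ / _) => t; lra.
have [c2 c20 c2P] : exists2 c2, 0 <= c2 & (c2 * a + 2 * K <= c2).
  exists (2 * K / (1 - a)); first by rewrite divr_ge0 ?mulr_ge0 ?subr_ge0// ltW.
  rewrite -lerBrDl -{1}[_ / _]mulr1 -mulrBr divfK//.
  by rewrite subr_eq0 gt_eqF.
exists (c1 + c2), mu; split; [lra|by rewrite mu0|].
move=> x k0 G dl n G0 dl0 h1 h2.
pose y k := x k - r * x (k - 1).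
have yE k : poly_shift (\prod_(r <- r :: rs) (1 - r *: 'X)) x k
    = poly_shift (\prod_(r <- rs) (1 - r *: 'X)) y k.
  rewrite big_cons poly_shift_factor /poly_shift mulr_sumr -sumrB.
  by apply: eq_bigr => s _; rewrite /y mulrBr (addrAC k) mulrCA.
have y0 s : (s <= size rs)%N -> normc (y (k0 - s%:Z)) <= 2 * G.
  move=> srs; apply: le_trans (nD _ _) _; rewrite nN nM -/a.
  have e1 := h1 s (leqW srs); have := h1 s.+1 srs.
  rewrite intz_subS.
  move=> e2; have := ler_pM a0 (n0 _) (ltW r1) e2; lra.
have yn m : (m <= n)%N -> normc (y (k0 + m%:Z)) <= 2 * K * (lam ^+ m * G + dl).
  move=> mn; apply: le_trans (H y k0 (2 * G) dl m _ dl0 y0 _) _.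
  - by rewrite mulr_ge0.
  - by move=> j jm; rewrite -yE; apply: h2; exact: leq_trans jm mn.
  - have : 0 <= K * dl by exact: mulr_ge0.
    by move: (lam ^+ m) => q; lra.
have main m : (m <= n)%N -> normc (x (k0 + m%:Z)) <= c1 * (mu ^+ m * G) + c2 * dl.
  elim: m => [_|m IHm mn].
    have := h1 0%N isT; rewrite intz_subr0 ?intz_addr0 expr0 mul1r.
    have : 0 <= c2 * dl by exact: mulr_ge0.
    have : G <= c1 * G by rewrite ler_peMl.
    lra.
  have {}IHm := IHm (ltnW mn).
  have := yn _ mn; rewrite /y intz_addSK.
  move=> ym.
  have := nD (x (k0 + m.+1%:Z) - r * x (k0 + m%:Z)) (r * x (k0 + m%:Z)).
  rewrite subrK nM -/a => /le_trans; apply.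
  have e1 : a * normc (x (k0 + m%:Z)) <= a * (c1 * (mu ^+ m * G) + c2 * dl).
    exact: ler_wpM2l.
  have q0 : 0 <= mu ^+ m by rewrite exprn_ge0// ltW.
  have e2 : lam ^+ m.+1 <= mu ^+ m.
    rewrite exprSr; apply: le_trans (_ : lam ^+ m <= _).
      by rewrite ler_piMr// ?exprn_ge0// ltW.
    by rewrite lerXn2r ?nnegrE// ltW.
  have e3 : 2 * K * (lam ^+ m.+1 * G + dl) <= 2 * K * (mu ^+ m * G + dl).
    by rewrite ler_wpM2l ?mulr_ge0// lerD2r ler_wpM2r.
  have e4 : (c1 * a + 2 * K) * (mu ^+ m * G) <= c1 * mu * (mu ^+ m * G).
    by rewrite ler_wpM2r// mulr_ge0.
  have e5 : (c2 * a + 2 * K) * dl <= c2 * dl by rewrite ler_wpM2r.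
  rewrite exprS; move: e1 e3 e4 e5 ym; move: (normc _) (normc _) (mu ^+ m) (lam ^+ m.+1).
  by move=> A B M L; lra.
apply: le_trans (main n (leqnn _)) _.
have : 0 <= c2 * (mu ^+ n * G) by rewrite !mulr_ge0// exprn_ge0// ltW.
have : 0 <= c1 * dl by rewrite mulr_ge0// (le_trans ler01).
by move: (mu ^+ n * G) => M; lra.
Qed.

Lemma normc_real (a : R) : normc (real_complex R a) = `|a|.
Proof. by rewrite /= expr0n/= addr0 sqrtr_sqr. Qed.

(** With constant term 1, [C] is the product of the factors 1 - X/z over its complex roots z, and
    stability puts the reciprocals 1/z inside the unit disk. *)
Lemma stable_filter_bound (C : {poly R}) : C`_0 = 1 -> stable_poly C ->
  exists (K lam : R) (q : nat), [/\ 0 <= K, 0 < lam < 1 &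
    forall (x : int -> R) (k0 : int) (G dl : R) (n : nat), 0 <= G -> 0 <= dl ->
      (forall s : nat, (s <= q)%N -> `|x (k0 - s%:Z)| <= G) ->
      (forall j : nat, (j < n)%N -> `|shift_apply C x (k0 + j.+1%:Z)| <= dl) ->
      `|x (k0 + n%:Z)| <= K * (lam ^+ n * G + dl)].
Proof.
move=> C0 stC; pose Cc := map_poly (real_complex R) C.
have [r CE] := closed_field_poly_normal Cc.
have Cc0 : Cc != 0.
  by apply/eqP => /(congr1 (fun q : {poly R[i]} => q`_0)); rewrite coef_map coef0 C0 => /eqP; rewrite oner_eq0.
have rr z : z \in r -> 1 < normc z.
  move=> zr; have : root Cc z.
    by rewrite CE rootZ ?lead_coef_eq0// root_prod_XsubC.
  move=> /stC; rewrite normc_def => h.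
  by move: h; rewrite -(rmorph1 (real_complex R)) ltcR; case: z zr.
have rn0 z : z \in r -> z != 0.
  by move=> /rr; apply: contraTneq => ->; rewrite ComplexField.Normc.normc0 ltr10.
have CE' : Cc = \prod_(q <- [seq z^-1 | z <- r]) (1 - q *: 'X).
  rewrite big_map {1}CE.
  have -> : \prod_(z <- r) ('X - z%:P) = \prod_(z <- r) ((- z) *: (1 - z^-1 *: 'X)).
    apply: eq_big_seq => z /rn0 z0.
    by rewrite scalerBr scalerA mulNr mulfV// scaleNr scaleN1r opprK addrC alg_polyC.
  rewrite scaler_prod scalerA.
  (* This scalar is the value of [C] at 0. *)
  suff -> : lead_coef Cc * \prod_(z <- r) (- z) = 1 by rewrite scale1r.
  have e0 : Cc.[0] = 1 by rewrite horner_coef0 coef_map C0.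
  have := congr1 (fun q : {poly R[i]} => q.[0]) CE.
  rewrite e0 hornerZ horner_prod => E; rewrite [RHS]E.
  by congr (_ * _); apply: eq_bigr => z _; rewrite hornerXsubC sub0r.
have rs1 : all (fun r => normc r < 1) [seq z^-1 | z <- r].
  apply/allP => _ /mapP[z zr ->]; rewrite ComplexField.Normc.normcV invf_lt1 ?rr//.
  by rewrite (lt_trans ltr01)// rr.
have [K [lam [K0 lam01 H]]] := factor_filter_bound rs1.
exists K, lam, (size r); split => // x k0 G dl n G0 dl0 h1 h2.
rewrite -normc_real.
apply: (H (fun k => real_complex R (x k)) k0 G dl n G0 dl0).
  by move=> s; rewrite size_map => /h1; rewrite normc_real.
move=> j /h2; rewrite -CE' -normc_real; apply: le_trans.
rewrite le_eqVlt; apply/orP; left; apply/eqP; congr normc.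
rewrite /poly_shift /shift_apply size_map_poly rmorph_sum/=.
by apply: eq_bigr => s _; rewrite coef_map rmorphM.
Qed.

End Filter.

(** * Geometric decay and growth rates *)

Section Tracking.
Context (R : realType).

(** For rho = sqrt lam and rho (1 + h) = 1, Bernoulli's inequality bounds rho^j (1 + j h) by 1;
    squaring produces the quadratic factor. *)
Lemma geometric_decay (lam : R) : 0 < lam < 1 ->
  exists2 c, 0 < c & forall j : nat, lam ^+ j * j.+1%:R ^+ 2 <= c.
Proof.
move=> /andP[lam0 lam1].
pose rho := Num.sqrt lam.
have rho0 : 0 < rho by rewrite sqrtr_gt0.
have rho1 : rho < 1 by rewrite -sqrtr1 ltr_sqrt.
have rho2 : rho ^+ 2 = lam by rewrite sqr_sqrtr// ltW.
pose h := rho^-1 - 1.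
have h0 : 0 < h by rewrite subr_gt0 invf_gt1.
have rh : rho * h = 1 - rho by rewrite mulrBr mulfV ?mulr1// gt_eqF.
have bern j : rho ^+ j * (1 + j%:R * h) <= 1.
  elim: j => [|j IH]; first by rewrite mul0r addr0 expr0 mulr1.
  apply: le_trans IH; rewrite exprSr -mulrA ler_wpM2l ?exprn_ge0 ?(ltW rho0)//.
  have j0 : 0 <= j%:R :> R by [].
  rewrite -natr1 (_ : rho * _ = 1 + j%:R * (rho * h)); last first.
    by have -> : rho * (1 + (j%:R + 1) * h) = rho + j%:R * (rho * h) + rho * h; [ring|rewrite rh; ring].
  rewrite lerD2l ler_wpM2l// rh.
  have : 0 <= (1 - rho) * h by rewrite mulr_ge0 ?(ltW h0)// subr_ge0 ltW.
  by rewrite mulrBl mul1r rh; lra.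
pose c1 := 1 + h^-1.
have c10 : 0 < c1 by rewrite /c1 addr_gt0// invr_gt0.
exists (c1 ^+ 2); first by rewrite exprn_gt0.
move=> j; rewrite -rho2 -exprM mulnC exprM -exprMn.
have e0 : 0 <= rho ^+ j * j.+1%:R by rewrite mulr_ge0// exprn_ge0// ltW.
rewrite ler_sqr ?nnegrE ?(ltW c10)//.
apply: (@le_trans _ _ (rho ^+ j * (1 + j%:R * h) * c1)).
  rewrite -mulrA ler_wpM2l ?exprn_ge0 ?(ltW rho0)//.
  have hh : h * h^-1 = 1 by rewrite mulfV// gt_eqF.
  rewrite /c1 -natr1.
  have -> : (1 + j%:R * h) * (1 + h^-1) = 1 + h^-1 + j%:R * h + j%:R * (h * h^-1) by ring.
  rewrite hh mulr1; have j0 : 0 <= j%:R :> R by [].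
  have : 0 < h^-1 by rewrite invr_gt0.
  have : 0 <= j%:R * h by rewrite mulr_ge0// ltW.
  by move: (j%:R) (h^-1) => a b; lra.
by rewrite ler_piMl// ltW.
Qed.

Lemma archi_nat (x : R) : exists n : nat, x <= n%:R.
Proof. by exists (Num.truncn x).+1; rewrite ltW// truncnS_gt. Qed.

Lemma geometric_linear_small (lam c : R) (q : nat) (e : R) : 0 < lam < 1 -> 0 <= c -> 0 < e ->
  exists J : nat, forall j, (J <= j)%N -> c * (lam ^+ j * (j + q)%:R) <= e.
Proof.
move=> lam01 c0 e0; have [c1 c10 H] := geometric_decay lam01.
have lam0 : 0 <= lam by case/andP: lam01 => /ltW.
have [J HJ] := archi_nat (c * c1 * q.+1%:R / e).
exists J => j Jj.
have j0 : 0 < j.+1%:R :> R by [].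
have h1 : lam ^+ j * (j + q)%:R <= c1 * q.+1%:R / j.+1%:R.
  rewrite ler_pdivlMr//.
  apply: (@le_trans _ _ (lam ^+ j * j.+1%:R ^+ 2 * q.+1%:R)); last by rewrite ler_wpM2r.
  have nn : ((j + q) * j.+1 <= j.+1 ^ 2 * q.+1)%N by nia.
  have h : ((j + q) * j.+1)%:R <= (j.+1 ^ 2 * q.+1)%:R :> R by rewrite ler_nat.
  rewrite natrM natrM natrX in h.
  by have := ler_wpM2l (exprn_ge0 j lam0) h; rewrite !mulrA.
apply: (@le_trans _ _ (c * (c1 * q.+1%:R / j.+1%:R))); first by rewrite ler_wpM2l.
rewrite !mulrA ler_pdivrMr// -ler_pdivrMl//.
rewrite mulrC; apply: le_trans HJ _.
by rewrite ler_nat (leq_trans Jj).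
Qed.

(* k^(1/4) dominates every power of ln k, while k^(1/4) * sqrt k = o(k). *)
Definition root4 (k : nat) : R := Num.sqrt (Num.sqrt k%:R).

Lemma root4_ge0 k : 0 <= root4 k. Proof. exact: sqrtr_ge0. Qed.

Lemma le_root4 k l : (k <= l)%N -> root4 k <= root4 l.
Proof. by move=> kl; rewrite ler_wsqrtr// ler_wsqrtr// ler_nat. Qed.

Lemma root4_sqr k : root4 k ^+ 2 = Num.sqrt k%:R.
Proof. by rewrite sqr_sqrtr// sqrtr_ge0. Qed.

Lemma root4_exp4 k : root4 k ^+ 4 = k%:R.
Proof. by rewrite (exprM _ 2 2) root4_sqr sqr_sqrtr. Qed.

Lemma root4_ge1 k : (1 <= k)%N -> 1 <= root4 k.
Proof. by move=> k1; rewrite -[leLHS]sqrtr1 -[X in Num.sqrt X]sqrtr1 ler_wsqrtr// ler_wsqrtr// ler1n. Qed.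

Lemma root4_le_nat k l : (k <= l ^ 2)%N -> (1 <= l)%N -> root4 k <= l%:R.
Proof.
move=> kl l1; apply: (@le_trans _ _ (Num.sqrt (l%:R ^+ 2))).
  rewrite ler_wsqrtr// (@le_trans _ _ (Num.sqrt (l%:R ^+ 2)))//.
    by rewrite ler_wsqrtr// -natrX ler_nat.
  by rewrite sqrtr_sqr ger0_norm// -natrX ler_nat; nia.
by rewrite sqrtr_sqr ger0_norm.
Qed.

Lemma le_root4_exp4 (g C : R) k : 0 <= g -> 1 <= C -> g ^+ 4 <= C * k%:R -> g <= C * root4 k.
Proof.
move=> g0 C1 gC.
have C0 : 0 <= C by lra.
rewrite -(@ler_pXn2r _ 4)// ?nnegrE ?mulr_ge0 ?root4_ge0//.
rewrite exprMn root4_exp4; apply: le_trans gC _.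
by rewrite ler_wpM2r// ler_eXnr.
Qed.

Lemma log_power_growth (m : nat) (c cM : R) : 0 <= c -> 1 < cM ->
  exists2 C, 0 <= C & forall k : nat, (1 <= k)%N ->
    (1 + (c + ln (k%:R + cM))) ^+ m.+1 <= C * root4 k.
Proof.
move=> c0 cM1.
(* (1 + y / n)^n <= exp y with n = 4 (m + 1). *)
pose n : R := (4 * m.+1)%:R.
have n0 : 0 < n by rewrite ltr0n muln_gt0.
have n1 : 1 <= n by rewrite ler1n muln_gt0.
pose C : R := ((1 + c) * n) ^+ (4 * m.+1) * (1 + cM).
have C1 : 1 <= C.
  rewrite -[leLHS]mulr1; apply: ler_pM => //; last by lra.
  apply: exprn_ege1; rewrite -[leLHS]mulr1; apply: ler_pM => //; lra.
exists C; first by lra.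
move=> k k1.
have kk : 1 <= k%:R :> R by rewrite ler1n.
have l0 : 0 <= ln (k%:R + cM) by rewrite ln_ge0//; lra.
set y := ln _ in l0 *.
have kE : expR y = k%:R + cM by rewrite lnK// posrE; lra.
have key : ((1 + (c + y)) ^+ m.+1) ^+ 4 <= C * k%:R.
  rewrite -exprM mulnC.
  apply: (@le_trans _ _ (((1 + c) * n * (1 + y / n)) ^+ (4 * m.+1))).
    rewrite lerXn2r ?nnegrE ?mulr_ge0 ?addr_ge0 ?divr_ge0 ?(ltW n0)//.
    have -> : (1 + c) * n * (1 + y / n) = (1 + c) * n + (1 + c) * y * (n / n) by ring.
    rewrite divff ?gt_eqF// mulr1.
    have : 0 <= c * y by rewrite mulr_ge0.
    have : 0 <= (n - 1) * c by rewrite mulr_ge0// subr_ge0.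
    by nra.
  rewrite exprMn /C -[X in _ <= X]mulrA ler_wpM2l.
  - by [].
  - by rewrite exprn_ge0// mulr_ge0 ?(ltW n0)// addr_ge0.
  apply: (@le_trans _ _ (expR y)).
    have -> : expR y = expR (y / n) ^+ (4 * m.+1).
      by rewrite -expRM_natl mulrCA divff ?mulr1// gt_eqF.
    rewrite lerXn2r ?nnegrE ?expR_ge0 ?addr_ge0 ?divr_ge0 ?(ltW n0)//.
    exact: expR_ge1Dx.
  rewrite kE; have : 0 <= (k%:R - 1) * cM by rewrite mulr_ge0; lra.
  by lra.
apply: le_root4_exp4 => //.
by rewrite exprn_ge0// !addr_ge0.
Qed.

Lemma poly_growth (f : R -> R) (mu : R) : continuous f -> 0 <= mu -> bigO_power f mu ->
  exists2 K, 0 <= K & exists m : nat, forall u, `|f u| <= K * (1 + `|u|) ^+ m.+1.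
Proof.
move=> cf mu0 [K [B fB]].
have [m Hm] := archi_nat mu.
have [K1 HK1] : exists K1, forall x, `|x| <= `|B| -> `|f x| <= K1.
  have [M [_ HM]] : bounded_set (f @` `[- `|B|, `|B|]).
    apply: compact_bounded; apply: continuous_compact; last exact: segment_compact.
    exact: continuous_subspaceT.
  exists (M + 1) => x xB; apply: HM; first by rewrite ltrDl.
  by exists x => //=; rewrite in_itv/= -ler_norml.
exists (`|K| + `|K1|); first exact: addr_ge0.
exists m => u.
have u1 : 1 <= 1 + `|u| by rewrite lerDl.
have p1 : 1 <= (1 + `|u|) ^+ m.+1 by exact: exprn_ege1.
have [Bu|/ltW uB] := leP B `|u|.
  apply: le_trans (fB _ Bu) _.
  apply: (@le_trans _ _ (`|K| * (1 + `|u|) ^+ m.+1)).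
    apply: (@le_trans _ _ (`|K| * `|u| `^ mu)).
      by rewrite ler_wpM2r ?powR_ge0// ler_norm.
    rewrite ler_wpM2l//.
    apply: (@le_trans _ _ ((1 + `|u|) `^ mu)).
      by rewrite ge0_ler_powR ?nnegrE ?addr_ge0// lerDr.
    rewrite -powR_mulrn ?addr_ge0// ler_powR//.
    by apply: le_trans Hm _; rewrite ler_nat.
  by rewrite ler_wpM2r ?(le_trans ler01)// lerDl.
have : `|f u| <= K1 by apply: HK1; apply: le_trans uB (ler_norm _).
move=> /le_trans; apply; apply: le_trans (ler_norm _) _.
rewrite -[leLHS]mulr1; apply: ler_pM => //; by rewrite lerDr.
Qed.

End Tracking.

(** * Steady-state tracking by a stable linear filter *)

Lemma shift_apply_widen (R : realType) (E : {poly R}) n x k : (size E <= n)%N ->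
  shift_apply E x k = \sum_(s < n) E`_s * x (k - s%:Z).
Proof. exact: poly_shift_widen. Qed.

Lemma window_sqr (j k n q : nat) : (k <= n ^ 2)%N -> n = (q.+1 + j)%N ->
  (k + q.+1 <= (j + (q.+1 + q.+1)) ^ 2)%N.
Proof. by move=> kn nE; rewrite nE in kn; nia. Qed.

Section LinearTracking.
Context (R : realType) (C D : {poly R}).
Hypotheses (C0 : C`_0 = 1) (C_stable : stable_poly C).

Lemma stable_horner1_neq0 : C.[1] != 0.
Proof.
apply/negP => C10.
have : root (map_poly (real_complex R) C) (real_complex R 1) by rewrite fmorph_root.
by move=> /C_stable; rewrite (_ : real_complex R 1 = 1)// normr1 ltxx.
Qed.

(** The response to a constant unit input, that is, the ratio d_i / c_i of the static map. *)
Definition dc_gain : R := D.[1] / C.[1].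
Definition poly_gain (E : {poly R}) : R := \sum_(s < size E) `|E`_s|.

Lemma poly_gain_ge0 E : 0 <= poly_gain E.
Proof. exact: sumr_ge0. Qed.

Lemma shift_apply_le (E : {poly R}) (x : int -> R) k g : 0 <= g ->
  (forall s : nat, (s < size E)%N -> `|x (k - s%:Z)| <= g) ->
  `|shift_apply E x k| <= poly_gain E * g.
Proof.
move=> g0 xg; rewrite /shift_apply mulr_suml.
apply: le_trans (ler_norm_sum _ _ _) _; apply: ler_sum => s _.
by rewrite normrM ler_wpM2l// xg.
Qed.

(** [D - dc_gain *: C] vanishes at 1 and therefore kills constants, so the tracking error obeys the
    filter recursion driven only by recent differences of the input. *)
Lemma shift_apply_defect (x Y : int -> R) (k : int) :
  shift_apply C Y (k + 1) = shift_apply D x k ->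
  shift_apply C (fun j => Y (j + 1) - dc_gain * x j) k =
  shift_apply (D - dc_gain *: C) (fun j => x j - x k) k.
Proof.
move=> rec; pose n := maxn (size C) (size D).
have sE : (size (D - dc_gain *: C)%R <= n)%N.
  rewrite (leq_trans (size_polyD _ _))// size_polyN geq_max leq_maxr/=.
  by rewrite (leq_trans (size_scale_leq _ _))// leq_maxl.
have E1 : \sum_(s < n) (D - dc_gain *: C)`_s = 0.
  transitivity (D - dc_gain *: C).[1].
    by rewrite (horner_coef_wide _ sE); apply: eq_bigr => s _; rewrite expr1n mulr1.
  by rewrite hornerD hornerN hornerZ /dc_gain divfK ?subrr// stable_horner1_neq0.
move: rec.
rewrite !(@shift_apply_widen _ C n) ?leq_maxl// (@shift_apply_widen _ D n) ?leq_maxr//.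
rewrite (@shift_apply_widen _ _ n)// => rec.
under eq_bigr do rewrite mulrBr.
rewrite sumrB.
under [in X in X - _]eq_bigr do rewrite addrAC.
rewrite rec -sumrB.
under [RHS]eq_bigr do rewrite mulrBr.
rewrite [RHS]sumrB -[X in _ = _ - X]mulr_suml E1 mul0r subr0.
by apply: eq_bigr => s _; rewrite coefB coefZ; ring.
Qed.

Lemma linear_growth (x Y : int -> R) :
  (forall k : nat, (1 <= k)%N -> shift_apply C Y k.+1%:Z = shift_apply D x k%:Z) ->
  exists2 K, 0 <= K & forall (k : nat) g, 0 <= g ->
    (forall j : nat, (1 <= j <= k)%N -> `|x j%:Z| <= g) -> `|Y k.+1%:Z| <= K * (1 + g).
Proof.
move=> rec.
have [K [lam [q [K0 /andP[lam0 lam1] H]]]] := stable_filter_bound C0 C_stable.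
(* [G0] and [G1] collect the free initial values: outputs up to time 1 and inputs up to time 0. *)
pose G0 := \sum_(s < q.+1) `|Y (1 - s%:Z)|.
pose G1 := \sum_(t < size D) `|x (- t%:Z)|.
have G00 : 0 <= G0 by exact: sumr_ge0.
have G10 : 0 <= G1 by exact: sumr_ge0.
pose W := poly_gain D; have W0 : 0 <= W by exact: poly_gain_ge0.
exists (K * (G0 + W * (1 + G1))).
  by rewrite mulr_ge0// addr_ge0// mulr_ge0// addr_ge0.
move=> k g g0 xg.
have -> : k.+1%:Z = 1 + k%:Z by rewrite -PoszD add1n.
apply: le_trans (H Y 1 G0 (W * (g + G1)) k G00 _ _ _) _.
- by rewrite mulr_ge0// addr_ge0.
- move=> s sq; rewrite /G0 (bigD1 (Ordinal (sq : (s < q.+1)%N)))//=.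
  by rewrite lerDl sumr_ge0.
- move=> j jk; rewrite -PoszD add1n rec//.
  apply: shift_apply_le => [|s sD]; first exact: addr_ge0.
  have [sj|js] := leqP s j.
    rewrite subzn ?(leqW sj)//; apply: le_trans (xg _ _) _; last by rewrite lerDl.
    by rewrite subn_gt0 ltnS sj/= (leq_trans _ jk)// leq_subr.
  have tD : (s - j.+1 < size D)%N by rewrite (leq_ltn_trans (leq_subr _ _)).
  rewrite (_ : j.+1%:Z - s%:Z = - (s - j.+1)%N%:Z); last by rewrite -subzn// opprB.
  rewrite ler_wpDl// /G1 (bigD1 (Ordinal tD))//= lerDl sumr_ge0//.
- rewrite -mulrA ler_wpM2l//.
  have e1 : lam ^+ k * G0 <= G0 by rewrite ler_piMl// exprn_ile1// ltW.
  have e2 : 0 <= G0 * g by exact: mulr_ge0.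
  have e3 : 0 <= W * (G1 * g) by rewrite !mulr_ge0.
  have e4 : 0 <= W by [].
  by move: e1; move: (lam ^+ k) => l; nra.
Qed.

(* The condition k0 <= n^2 lets the window outlast a transient of size
   k0^(1/4), which decays geometrically. *)
Lemma linear_tracking : exists q : nat, forall (x Y : int -> R) (c : R), 0 <= c ->
  (forall k : nat, (1 <= k)%N -> shift_apply C Y k.+1%:Z = shift_apply D x k%:Z) ->
  (forall k : nat, (1 <= k)%N -> `|x k%:Z| <= c * root4 R k) ->
  (forall k : nat, (1 <= k)%N -> `|Y k.+1%:Z| <= c * root4 R k) ->
  forall dl, 0 < dl -> exists2 dl', 0 < dl' & exists K0 : nat, forall k0 n : nat,
    (K0 <= k0)%N -> (k0 <= n ^ 2)%N ->
    (forall i j : nat, (k0 <= i <= j)%N -> (j <= k0 + n)%N -> (j <= i + q)%N ->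
       `|x i%:Z - x j%:Z| <= dl') ->
    `|Y (k0 + n).+1%:Z - dc_gain * x (k0 + n)%:Z| <= dl.
Proof.
have [K [lam [q0 [K0 lam01 H]]]] := stable_filter_bound C0 C_stable.
pose E := D - dc_gain *: C.
pose q := maxn q0 (size E).
exists q => x Y c c0 rec xc Yc dl dl0.
pose W := poly_gain E; have W0 : 0 <= W by exact: poly_gain_ge0.
pose k' := `|dc_gain|.
pose dl' := dl / 2 / (K * W + 1).
have KW : 0 < K * W + 1 by rewrite ltr_wpDl// mulr_ge0.
have dl'0 : 0 < dl' by rewrite !divr_gt0.
exists dl' => //.
have [J HJ] := @geometric_linear_small R lam (K * (c * (1 + k'))) (q.+1 + q.+1) (dl / 2)
  lam01 (mulr_ge0 K0 (mulr_ge0 c0 (addr_ge0 ler01 (normr_ge0 _)))) (divr_gt0 dl0 (ltr0Sn _ 1)).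
exists ((J + q.+1) ^ 2).+1 => k0 n Kk0 k0n xdl.
have Jn : (J + q.+1 <= n)%N.
  rewrite leqNgt; apply/negP => h.
  have : (n ^ 2 <= (J + q.+1) ^ 2)%N by rewrite leq_exp2r// ltnW.
  by move: k0n Kk0; clear; lia.
pose j := (n - q.+1)%N.
have nE : n = (q.+1 + j)%N by rewrite /j; move: Jn; clear; lia.
(* Starting [q.+1] steps late keeps every past value seen by the error recursion after [k0], where
   the input is known to vary slowly. *)
pose k1 := (k0 + q.+1)%N.
have k01 : (1 <= k0)%N by exact: leq_ltn_trans Kk0.
pose r (i : int) := Y (i + 1) - dc_gain * x i.
have rb (i : nat) : (1 <= i)%N -> (i <= k1)%N -> `|r i%:Z| <= c * (1 + k') * root4 R k1.
  move=> i1 ik; rewrite /r -PoszD addn1.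
  apply: le_trans (ler_normB _ _) _; rewrite normrM -/k'.
  have h1 := le_trans (Yc _ i1) (ler_wpM2l c0 (le_root4 R ik)).
  have h2 := le_trans (xc _ i1) (ler_wpM2l c0 (le_root4 R ik)).
  have h3 : k' * `|x i| <= k' * (c * root4 R k1) by rewrite ler_wpM2l// normr_ge0.
  by move: h1 h3; lra.
have k1j : root4 R k1 <= (j + (q.+1 + q.+1))%:R.
  apply: root4_le_nat; last by rewrite addnA addnS.
  exact: (window_sqr k0n nE).
have main : `|r (k1%:Z + j%:Z)| <= K * (lam ^+ j * (c * (1 + k') * root4 R k1) + W * dl').
  apply: (H r k1%:Z _ _ j).
  - by rewrite mulr_ge0 ?root4_ge0// mulr_ge0// addr_ge0 ?normr_ge0.
  - by rewrite mulr_ge0// ltW.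
  - move=> s sq.
    have sk : (s <= k1)%N by rewrite (leq_trans sq)// (leq_trans (leq_maxl _ (size E)))// /k1 -/q; clear; lia.
    rewrite subzn//; apply: rb; last exact: leq_subr.
    by rewrite /k1; have := leq_maxl q0 (size E); rewrite -/q; move: sq k01; clear; lia.
  - move=> i ij; rewrite -PoszD addnS shift_apply_defect; last first.
      by rewrite -PoszD addn1 rec.
    apply: shift_apply_le => [|s sE]; first exact: ltW.
    have sq : (s <= q)%N by rewrite (leq_trans (ltnW sE))// leq_maxr.
    rewrite subzn; last by rewrite /k1; move: sq; clear; lia.
    by apply: xdl; rewrite /k1; move: ij sq nE; clear; lia.
have -> : (k0 + n)%N = (k1 + j)%N by rewrite /k1 nE addnA.
have -> : (k1 + j).+1%:Z = (k1 + j)%N%:Z + 1 by rewrite -PoszD addn1.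
have := main; rewrite -PoszD /r => /le_trans; apply.
have hj : (J <= j)%N by move: Jn nE; clear; lia.
have e1 := HJ j hj.
have e2 : K * (W * dl') <= dl / 2.
  rewrite mulrA; apply: (@le_trans _ _ ((K * W + 1) * dl')).
    by rewrite ler_wpM2r ?(ltW dl'0)// lerDl.
  by rewrite /dl' mulrC divfK// gt_eqF.
have e3 : K * (lam ^+ j * (c * (1 + k') * root4 R k1)) <=
          K * (c * (1 + k')) * (lam ^+ j * (j + (q.+1 + q.+1))%:R).
  rewrite (_ : K * (c * (1 + k')) * _ = K * (lam ^+ j * (c * (1 + k') * (j + (q.+1 + q.+1))%:R))); last by ring.
  have l0 : 0 <= lam ^+ j by rewrite exprn_ge0// ltW//; case/andP: lam01.
  by rewrite !ler_wpM2l// mulr_ge0// addr_ge0 ?normr_ge0.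
by rewrite mulrDr; lra.
Qed.

End LinearTracking.

(** * Growth and tracking for a single agent *)

Section AgentTracking.
Context (R : realType) (A : agent R) (cM : R) (u v y : int -> R) (c : R).
Hypotheses (A_stable : stable_poly (polC A)) (A_cont : continuous (nonlin A)).
Hypothesis A_growth : exists2 mu : R, 0 < mu & bigO_power (nonlin A) mu.
Hypothesis dyn : agent_dynamics A u v y.
Hypotheses (cM1 : 1 < cM) (c0 : 0 <= c).
Hypothesis u_log : forall k : nat, (1 <= k)%N -> `|u k%:Z| <= c + ln (k%:R + cM).

(** Both kinds of agent contain the same linear filter, with the nonlinearity before or after it;
    isolating the filter lets one tracking result serve both. *)
Definition linear_input := if kind A is Hammerstein then v else u.
Definition linear_output := if kind A is Hammerstein then y else v.

Lemma linear_part (k : nat) : (1 <= k)%N ->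
  shift_apply (polC A) linear_output k.+1%:Z = shift_apply (polD A) linear_input k%:Z.
Proof.
by move=> /dyn; rewrite /linear_output /linear_input; case: (kind A) => -[].
Qed.

(** Logarithmic controls pass through a filter and a nonlinearity of polynomial growth, so every
    signal is bounded by a power of a logarithm. The factor (1 + KL)^(m+1) is the cost of applying
    the nonlinearity after the filter, in the Wiener case. *)
Lemma agent_output_growth : exists2 C, 0 <= C & forall k : nat, (1 <= k)%N ->
  [/\ `|linear_input k%:Z| <= C * root4 R k, `|linear_output k.+1%:Z| <= C * root4 R k
    & `|y k.+1%:Z| <= C * root4 R k].
Proof.
have [mu mu0 fmu] := A_growth.
have [Kf Kf0 [m fK]] := poly_growth A_cont (ltW mu0) fmu.
have [C C0 HC] := log_power_growth m c0 cM1.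
have [KL KL0 HL] := linear_growth (polC0 A) A_stable linear_part.
pose g (k : nat) := 1 + (c + ln (k%:R + cM)).
have g1 k : 1 <= g k.
  by rewrite /g lerDl addr_ge0// ln_ge0// ler_wpDl// ltW.
have gm1 k : g k <= g k ^+ m.+1 by rewrite ler_eXnr.
have gmono j k : (j <= k)%N -> g j <= g k.
  have cM0 := lt_trans ltr01 cM1.
  by move=> jk; rewrite /g !lerD2l ler_ln ?posrE ?ltr_wpDl// lerD2r ler_nat.
have g0 k : 0 <= g k := le_trans ler01 (g1 k).
have ug j : (1 <= j)%N -> 1 + `|u j%:Z| <= g j by move=> /u_log; rewrite /g lerD2l.
have fu x k : 1 + `|x| <= g k -> `|nonlin A x| <= Kf * g k ^+ m.+1.
  move=> xg; apply: le_trans (fK x) _; rewrite ler_wpM2l// lerXn2r ?nnegrE//.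
have pow0 k : 1 <= g k ^+ m.+1 by apply: le_trans (gm1 k).
have lin_in j k : (1 <= j <= k)%N -> `|linear_input j%:Z| <= (Kf + 1) * g k ^+ m.+1.
  move=> /andP[j1 jk]; have hg := le_trans (ug _ j1) (gmono _ _ jk).
  have h := fu _ _ hg; have := gm1 k; have := pow0 k.
  rewrite /linear_input; have := dyn j1; case: (kind A) => -[].
    by move=> -> _ *; lra.
  move=> _ _ p1 p2.
  have : 0 <= Kf * g k ^+ m.+1 by rewrite mulr_ge0// (le_trans ler01).
  have := normr_ge0 (u j%:Z); lra.
have lin_out k : (1 <= k)%N -> `|linear_output k.+1%:Z| <= KL * (Kf + 2) * g k ^+ m.+1.
  move=> k1; apply: (@le_trans _ _ (KL * (1 + (Kf + 1) * g k ^+ m.+1))).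
    apply: HL => [|j]; last exact: lin_in.
    by rewrite mulr_ge0 ?addr_ge0// (le_trans ler01).
  rewrite -mulrA ler_wpM2l//; have := pow0 k; lra.
have yb k : (1 <= k)%N ->
    `|y k.+1%:Z| <= (KL * (Kf + 2) + Kf * (1 + KL) ^+ m.+1) * g k ^+ m.+1.
  move=> k1; have lo := lin_out k k1.
  have p0 : 0 <= g k ^+ m.+1 by rewrite (le_trans ler01).
  have q0 : 0 <= (1 + KL) ^+ m.+1 by rewrite exprn_ge0// addr_ge0.
  rewrite mulrDl; case E : (kind A).
    move: lo; rewrite /linear_output E => lo.
    by rewrite ler_wpDr// !mulr_ge0.
  have := dyn k1; rewrite E => -[_ ->].
  have vb : `|v k.+1%:Z| <= KL * g k.
    have : `|linear_output k.+1%:Z| <= KL * (1 + (c + ln (k%:R + cM))).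
      apply: HL => [|j /andP[j1 jk]].
        by have := g1 k; rewrite /g; lra.
      rewrite /linear_input E; have := ug _ j1; have := gmono _ _ jk.
      by rewrite /g; lra.
    by rewrite /linear_output E.
  apply: ler_wpDl; first by rewrite !mulr_ge0// addr_ge0.
  apply: le_trans (fK _) _; rewrite -mulrA -exprMn ler_wpM2l//.
  have h : 1 + `|v k.+1%:Z| <= (1 + KL) * g k.
    by move: (g1 k) vb; move: (g k) `|_| => a b; lra.
  by rewrite lerXn2r ?nnegrE ?addr_ge0// mulr_ge0// addr_ge0.
pose Kt := (Kf + 1) + KL * (Kf + 2) + (KL * (Kf + 2) + Kf * (1 + KL) ^+ m.+1).
have K1 : 0 <= KL * (Kf + 2) by rewrite mulr_ge0// addr_ge0.
have K2 : 0 <= Kf * (1 + KL) ^+ m.+1 by rewrite mulr_ge0// exprn_ge0// addr_ge0.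
have Kt0 : 0 <= Kt by rewrite /Kt; lra.
exists (Kt * C); first exact: mulr_ge0.
move=> k k1.
have fin z t : z <= t * g k ^+ m.+1 -> t <= Kt -> z <= Kt * C * root4 R k.
  move=> zt tK; apply: le_trans zt _; apply: (@le_trans _ _ (Kt * g k ^+ m.+1)).
    by rewrite ler_wpM2r// (le_trans ler01).
  by rewrite -mulrA ler_wpM2l// HC.
split.
- by apply: (fin _ _ (lin_in k k _)); [rewrite k1/=|rewrite /Kt; lra].
- by apply: (fin _ _ (lin_out _ k1)); rewrite /Kt; lra.
- by apply: (fin _ _ (yb _ k1)); rewrite /Kt; lra.
Qed.

Lemma slow_variation (k0 n : nat) (eta : R) : 0 <= eta ->
  (forall j : nat, (k0 <= j < k0 + n)%N -> `|u j.+1%:Z - u j%:Z| <= eta) ->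
  forall i j q : nat, (k0 <= i <= j)%N -> (j <= k0 + n)%N -> (j <= i + q)%N ->
  `|u i%:Z - u j%:Z| <= q%:R * eta.
Proof.
move=> eta0 ueta i j q /andP[k0i ij] jn jq.
suff h : forall d : nat, (i + d <= k0 + n)%N -> `|u i%:Z - u (i + d)%N%:Z| <= d%:R * eta.
  have := h (j - i)%N; rewrite subnKC// => /(_ jn) /le_trans; apply.
  by rewrite ler_wpM2r// ler_nat leq_subLR.
elim=> [|d IH]; first by rewrite addn0 subrr normr0 mul0r.
rewrite addnS => idn.
rewrite (_ : _ - _ = (u i%:Z - u (i + d)%N%:Z) - (u (i + d).+1%:Z - u (i + d)%N%:Z)); last by ring.
apply: le_trans (ler_normB _ _) _; rewrite -natr1 mulrDl mul1r lerD ?IH 1?ltnW//.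
by apply: ueta; rewrite idn andbT (leq_trans k0i)// leq_addr.
Qed.

(** Uniform continuity acts on the filter input of a Hammerstein agent and on the filter output of a
    Wiener agent. The one-step tolerance carries the divisor [q.+1] because the filter compares
    inputs up to [q] steps apart. *)
Lemma agent_tracking (B dl : R) : 0 < dl ->
  exists2 eta, 0 < eta & exists K0 : nat, forall k0 n : nat,
    (K0 <= k0)%N -> (k0 <= n ^ 2)%N ->
    (forall j : nat, (k0 <= j <= k0 + n)%N -> `|u j%:Z| <= B) ->
    (forall j : nat, (k0 <= j < k0 + n)%N -> `|u j.+1%:Z - u j%:Z| <= eta) ->
    `|y (k0 + n).+1%:Z - static_map A (u (k0 + n)%N%:Z)| <= dl.
Proof.
move=> dl0.
have [C C0 HC] := agent_output_growth.
have [q Hq] := linear_tracking (polD A) (polC0 A) A_stable.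
have {}Hq := Hq linear_input linear_output C C0 linear_part
  (fun k k1 => let: And3 a _ _ := HC k k1 in a) (fun k k1 => let: And3 _ b _ := HC k k1 in b).
have q1 : 0 < q.+1%:R :> R by [].
have qle (eta : R) : 0 <= eta -> q%:R * (eta / q.+1%:R) <= eta.
  move=> eta0; rewrite mulrCA ler_piMr// ler_pdivrMr// mul1r ler_nat//.
case E : (kind A).
  have [dl' dl'0 [K0 HK]] := Hq _ dl0.
  have [r r0 Hr] := continuous_unif_segment B A_cont dl'0.
  exists (r / q.+1%:R); first by rewrite divr_gt0.
  exists K0.+1 => k0 n kk k0n uB ueta.
  have k01 : (1 <= k0)%N by exact: leq_ltn_trans kk.
  have vf (j : nat) : (1 <= j)%N -> v j%:Z = nonlin A (u j%:Z).
    by move=> /dyn; rewrite E => -[].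
  have := HK k0 n (ltnW kk) k0n.
  rewrite /linear_input /linear_output /static_map E -/(dc_gain _ _).
  rewrite vf; last by rewrite (leq_trans k01)// leq_addr.
  apply => i j /andP[k0i ij] jn jq.
  rewrite !vf ?(leq_trans k01)// ?(leq_trans k0i)//.
  apply: Hr; first by apply: uB; rewrite k0i (leq_trans ij).
  apply: (@le_trans _ _ (q%:R * (r / q.+1%:R))); last by apply: qle; exact: ltW.
  apply: (slow_variation _ ueta) => //; first by rewrite divr_ge0// ltW.
  by rewrite k0i.
have [r r0 Hr] := continuous_unif_segment (`|dc_gain (polC A) (polD A)| * B) A_cont dl0.
have [dl' dl'0 [K0 HK]] := Hq _ r0.
exists (dl' / q.+1%:R); first by rewrite divr_gt0.
exists K0.+1 => k0 n kk k0n uB ueta.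
have k01 : (1 <= k0)%N by exact: leq_ltn_trans kk.
have := HK k0 n (ltnW kk) k0n.
rewrite /linear_input /linear_output /static_map E -/(dc_gain _ _) => h.
have -> : y (k0 + n).+1%:Z = nonlin A (v (k0 + n).+1%:Z).
  have kn1 : (1 <= k0 + n)%N by rewrite (leq_trans k01)// leq_addr.
  by have := dyn kn1; rewrite E => -[].
rewrite distrC; apply: Hr.
  by rewrite normrM ler_wpM2l// uB// leq_addr leqnn.
rewrite distrC; apply: h => i j /andP[k0i ij] jn jq.
apply: (@le_trans _ _ (q%:R * (dl' / q.+1%:R))); last by apply: qle; exact: ltW.
apply: (slow_variation _ ueta) => //; first by rewrite divr_ge0// ltW.
by rewrite k0i.
Qed.

End AgentTracking.

(** * The Lyapunov function *)

Section Potential.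
Context (R : realType) (N : nat) (p : 'M[R]_N) (e : rel 'I_N) (i0 : 'I_N).
Hypotheses (p_adj : adjacency_matrix e p) (e_conn : connected_graph e).
Context (pi : 'I_N -> R).
Hypotheses (pi_gt0 : forall i, 0 < pi i)
  (pi_null : forall b, \sum_i pi i * laplacian p b i = 0).
Context (h H : 'I_N -> R -> R).
Hypotheses (h_cont : forall i, continuous (h i))
  (h_mono : forall i, {homo h i : x y / x < y})
  (h_surj : forall i z, exists x, h i x = z)
  (H_sub : forall i a b, H i b - H i a <= h i b * (b - a)).

Definition potential (w : 'I_N -> R) : R := \sum_i pi i * H i (w i).
Definition weighted_sum (w : 'I_N -> R) : R := \sum_i pi i * w i.
Definition dissipation (w : 'I_N -> R) : R := energy p pi (fun i => h i (w i)).

Lemma h_le i : {mono h i : x y / x <= y}.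
Proof. exact/le_mono/h_mono. Qed.

Lemma h_bounded B : exists2 Z, 0 <= Z & forall i x, `|x| <= B -> `|h i x| <= Z.
Proof.
have [Z Z0 HZ] := upper_bound_fin (fun i => `|h i B| + `|h i (- B)|).
exists Z => // i x; rewrite ler_norml => /andP[Bx xB].
apply: le_trans (HZ i).
have h1 : h i x <= h i B by rewrite h_le.
have h2 : h i (- B) <= h i x by rewrite h_le.
have := ler_norm (h i B); have := ler_norm (- h i (- B)); rewrite normrN.
have := normr_ge0 (h i B); have := normr_ge0 (h i (- B)).
by rewrite ler_norml; move: h1 h2; lra.
Qed.

Lemma h_unif (B d : R) : 0 < d -> exists2 r, 0 < r &
  forall i x y, `|x| <= B -> `|x - y| <= r -> `|h i x - h i y| <= d.
Proof.
move=> d0.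
have unif i : exists r, 0 < r /\ forall x y, `|x| <= B -> `|x - y| <= r -> `|h i x - h i y| <= d.
  by have [r r0 Hr] := continuous_unif_segment B (@h_cont i) d0; exists r.
pose f i : R := projT1 (cid (unif i)).
have f0 i : 0 < f i by rewrite /f; case: cid => /= ? [].
have [r r0 rf] := pos_lower_bound f0.
exists r => // i x y xB xy.
by have := rf i; rewrite /f; case: cid => /= s [_ Hs] rs; apply: Hs => //; exact: le_trans rs.
Qed.

(** Two errors are controlled: the direction uses the outputs [z] instead of [h (w)], and convexity
    supplies slopes at [w'] instead of [w]. Both scale with [a], so the loss is compared with the
    dissipation at every step size. *)
Lemma descent (B eta : R) : 0 < eta -> exists2 dl, 0 < dl &
  forall (w w' z : 'I_N -> R) (a : R), 0 <= a ->
    (forall i, `|w i| <= B) -> (forall i, `|w i - w' i| <= dl) ->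
    (forall i, `|z i - h i (w i)| <= dl) ->
    (forall i, w' i = w i - a * laplacian p z i) ->
    potential w' <= potential w - a * (dissipation w - eta).
Proof.
move=> eta0.
have [c c0 Hc] := laplacian_form_bound p_adj pi_gt0.
have [Z Z0 HZ] := h_bounded B.
(* The errors sum to c (d1 (Z + d1) + Z d1), which is at most c (2 Z + 1) d1 once d1 <= 1. *)
pose d1 := Num.min 1 (eta / (c * (2 * Z + 1) + 1)).
have cz : 0 <= c * (2 * Z + 1) by rewrite mulr_ge0// addr_ge0// mulr_ge0.
have d10 : 0 < d1 by rewrite lt_min ltr01/= divr_gt0// ltr_wpDl.
have d11 : d1 <= 1 by rewrite ge_min lexx.
have d1e : c * (2 * Z + 1) * d1 <= eta.
  apply: (@le_trans _ _ ((c * (2 * Z + 1) + 1) * d1)).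
    by rewrite ler_wpM2r ?(ltW d10)// lerDl.
  by rewrite mulrC -ler_pdivlMr ?ltr_wpDl// ge_min lexx orbT.
have [r r0 Hr] := h_unif B d10.
exists (Num.min r d1); first by rewrite lt_min r0.
move=> w w' z a a0 wB ww' zh w'E.
have hd i : `|h i (w' i) - h i (w i)| <= d1.
  by rewrite distrC Hr//; have := ww' i; rewrite le_min => /andP[].
have zd i : `|z i - h i (w i)| <= d1 by have := zh i; rewrite le_min => /andP[].
have hZ i : `|h i (w i)| <= Z by exact: HZ.
have zZ i : `|z i| <= Z + d1.
  rewrite -[z i](subrK (h i (w i))) addrC; apply: le_trans (ler_normD _ _) _.
  by rewrite lerD.
have lapB i : laplacian p (fun j => z j - h j (w j)) i = laplacian p z i - laplacian p (fun j => h j (w j)) i.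
  by rewrite /laplacian -sumrB; apply: eq_bigr => j _; ring.
have split : \sum_i pi i * (h i (w' i) * laplacian p z i) - dissipation w =
    \sum_i pi i * ((h i (w' i) - h i (w i)) * laplacian p z i) +
    \sum_i pi i * (h i (w i) * laplacian p (fun j => z j - h j (w j)) i).
  rewrite /dissipation /energy -sumrB -big_split/=; apply: eq_bigr => i _.
  by rewrite lapB; ring.
have b1 := Hc _ _ _ _ (ltW d10) (addr_ge0 Z0 (ltW d10)) hd zZ.
have b2 := Hc _ _ _ _ Z0 (ltW d10) hZ zd.
have lower : dissipation w - eta <= \sum_i pi i * (h i (w' i) * laplacian p z i).
  have e1 : c * (d1 * (Z + d1)) + c * (Z * d1) <= eta.
    apply: le_trans d1e; rewrite -mulrDr -mulrA ler_wpM2l//.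
    have : d1 * d1 <= 1 * d1 by rewrite ler_wpM2r// ltW.
    by lra.
  move: b1 b2 split; rewrite !ler_norml => /andP[b1 _] /andP[b2 _].
  by move: e1; lra.
(* Convexity: the secant slopes are bounded by the slope at the new point. *)
have up : potential w' - potential w <= - a * \sum_i pi i * (h i (w' i) * laplacian p z i).
  rewrite /potential -sumrB mulr_sumr; apply: ler_sum => i _.
  rewrite -mulrBr mulrCA ler_wpM2l ?(ltW (pi_gt0 _))//.
  apply: le_trans (H_sub _ _ _) _; rewrite w'E.
  by rewrite le_eqVlt; apply/orP; left; apply/eqP; ring.
have := ler_wpM2l a0 lower; move: up; rewrite mulNr; lra.
Qed.

Lemma potential_coercive c : exists B, forall w, potential w <= c -> forall i, `|w i| <= B.
Proof.
have Hlow i : exists C, forall x, `|x| - C <= H i x.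
  (* Subgradients of slope 1 and -1 give two supporting lines, whose maximum is |x| up to a
     constant. *)
  have [b hb] := h_surj i 1; have [b' hb'] := h_surj i (- 1).
  exists (`|b - H i b| + `|- b' - H i b'|) => x.
  have h1 := H_sub i x b; have h2 := H_sub i x b'; rewrite hb hb' in h1 h2.
  have := ler_norm (b - H i b); have := ler_norm (- b' - H i b').
  have := normr_ge0 (b - H i b); have := normr_ge0 (- b' - H i b').
  move: `|b - _| `|- b' - _| => s t s0 t0 hs ht.
  by have [x0|x0] := leP 0 x; [rewrite ger0_norm//|rewrite ltr0_norm//]; lra.
pose C i : R := projT1 (cid (Hlow i)).
have HC i x : `|x| - C i <= H i x by rewrite /C; case: cid.
have [m m0 mpi] := pos_lower_bound pi_gt0.
exists ((c + \sum_i pi i * C i) / m) => w wc i.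
have h1 : \sum_i pi i * `|w i| <= c + \sum_i pi i * C i.
  rewrite -lerBlDr -sumrB; apply: le_trans wc; apply: ler_sum => j _.
  by rewrite -mulrBr ler_wpM2l// ltW.
rewrite ler_pdivlMr//; apply: le_trans h1.
rewrite (bigD1 i)//= mulrC; apply: ler_wpDr; last by rewrite ler_wpM2r.
by apply: sumr_ge0 => j _; rewrite mulr_ge0// ltW.
Qed.

Lemma potential_bounded B : exists c, forall w, (forall i, `|w i| <= B) -> potential w <= c.
Proof.
have [Z Z0 HZ] := h_bounded B.
exists (\sum_i pi i * (H i 0 + Z * B)) => w wB.
apply: ler_sum => i _; rewrite ler_wpM2l ?(ltW (pi_gt0 _))//.
have := H_sub i 0 (w i); rewrite subr0 => hh.
have : h i (w i) * w i <= Z * B.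
  by apply: le_trans (ler_norm _) _; rewrite normrM ler_pM// HZ.
by lra.
Qed.

Lemma weighted_sum_le (w w' : 'I_N -> R) : weighted_sum w <= weighted_sum w' ->
  exists i, w i <= w' i.
Proof.
move=> ww'; apply/not_existsP => lt.
have : weighted_sum w' < weighted_sum w; last by rewrite ltNge ww'.
have l i : w' i < w i by rewrite ltNge; apply/negP/lt.
rewrite /weighted_sum (bigD1 i0)//= [ltRHS](bigD1 i0)//=.
apply: ltr_leD; first by rewrite ltr_pM2l.
by apply: ler_sum => i _; rewrite ler_wpM2l ?(ltW (pi_gt0 _))// ltW.
Qed.

(** The bounded weighted sum puts one coordinate below S/P and one above -S/P. Low dissipation keeps
    all values [h i (w i)] within 1 of each other, hence in a fixed interval, and surjectivity with
    monotonicity turns this into a bound on every coordinate. *)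
Lemma near_critical_bounded S : exists2 eta, 0 < eta & exists B, forall w,
  `|weighted_sum w| <= S -> dissipation w <= eta -> forall i, `|w i| <= B.
Proof.
have [eta eta0 Heta] := energy_spread p_adj e_conn pi_gt0 pi_null (@ltr01 R).
exists eta => //.
pose P := \sum_i pi i.
have P0 : 0 < P by rewrite /P (bigD1 i0)//= ltr_pwDl// sumr_ge0// => i _; exact: ltW.
have csum (s : R) : weighted_sum (fun=> s) = s * P.
  by rewrite /weighted_sum -mulr_suml mulrC.
have [Tt T0 HT] := upper_bound_fin (fun i => `|h i (S / P)| + `|h i (- (S / P))|).
pose b i : R := projT1 (cid (h_surj i (Tt + 1))).
have hb i : h i (b i) = Tt + 1 by rewrite /b; case: cid.
pose b' i : R := projT1 (cid (h_surj i (- (Tt + 1)))).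
have hb' i : h i (b' i) = - (Tt + 1) by rewrite /b'; case: cid.
have [B _ HB] := upper_bound_fin (fun i => `|b i| + `|b' i|).
exists B => w; rewrite ler_norml => /andP[S1 S2] /Heta spread j.
have [i1 wi1] : exists i, w i <= S / P.
  by apply: (weighted_sum_le (w' := fun=> S / P)); rewrite csum divfK// gt_eqF.
have [i2 wi2] : exists i, - (S / P) <= w i.
  by apply: (weighted_sum_le (w := fun=> - (S / P))); rewrite csum mulNr divfK// gt_eqF.
have z1 : h i1 (w i1) <= Tt.
  apply: (@le_trans _ _ (h i1 (S / P))); first by rewrite h_le.
  apply: le_trans (HT i1); apply: le_trans (ler_norm _) _; by rewrite lerDl.
have z2 : - Tt <= h i2 (w i2).
  apply: (@le_trans _ _ (h i2 (- (S / P)))); last by rewrite h_le.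
  rewrite lerNl; apply: le_trans (HT i2); apply: le_trans (ler_norm _) _.
  by rewrite normrN lerDr.
have u1 : w j <= b j.
  by rewrite -(h_le j) hb; have := spread j i1; rewrite ler_norml => /andP[_]; lra.
have u2 : b' j <= w j.
  by rewrite -(h_le j) hb'; have := spread j i2; rewrite ler_norml => /andP[+ _]; lra.
apply: le_trans (HB j).
have := ler_norm (b j); have := ler_norm (- b' j); rewrite normrN.
have := normr_ge0 (b j); have := normr_ge0 (b' j).
by rewrite ler_norml; move: u1 u2; lra.
Qed.

(** The common value c solves a scalar equation for the weighted sum of the inverse maps. The
    intermediate value theorem applies because comparison with the constant vector S/P brackets the
    solution. *)
Lemma equilibrium_exists S : exists (x : 'I_N -> R) (c : R),
  (forall i, h i (x i) = c) /\ weighted_sum x = S.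
Proof.
pose g i z : R := projT1 (cid (h_surj i z)).
have hg i z : h i (g i z) = z by rewrite /g; case: cid.
have gh i x : g i (h i x) = x.
  by apply/eqP; rewrite eq_le; apply/andP; split; rewrite -(h_le i) hg.
have gle i : {mono g i : x y / x <= y} by move=> x y; rewrite -(h_le i) !hg.
have gc i : continuous (g i).
  move=> z; apply/cvgrPdist_le => r r0.
  near=> t.
  rewrite ler_distlC; apply/andP; split.
    rewrite -[_ - r](gh i) gle ltW//; near: t.
    apply: lt_nbhsr; rewrite -{2}(hg i z); apply: h_mono.
    by rewrite ltrBlDr ltrDl.
  rewrite -[_ + r](gh i) gle ltW//; near: t.
  apply: lt_nbhsl; rewrite -{1}(hg i z); apply: h_mono.
  by rewrite ltrDl.
pose G z := weighted_sum (fun i => g i z).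
have Gc : continuous G.
  rewrite /G /weighted_sum; elim: (index_enum _) => [|i r IH] z.
    have -> : (fun z => \sum_(i <- [::]) pi i * g i z) = cst 0.
      by apply/funext => t; rewrite big_nil.
    exact: cvg_cst.
  have -> : (fun z => \sum_(j <- i :: r) pi j * g j z) =
      (fun z => pi i * g i z + \sum_(j <- r) pi j * g j z).
    by apply/funext => t; rewrite big_cons.
  by apply: cvgD; [apply: cvgM; [exact: cvg_cst|exact: gc]|exact: IH].
pose P := \sum_i pi i.
have P0 : 0 < P by rewrite /P (bigD1 i0)//= ltr_pwDl// sumr_ge0// => i _; exact: ltW.
have csum (s : R) : weighted_sum (fun=> s) = s * P.
  by rewrite /weighted_sum -mulr_suml mulrC.
have [b b0 Hb] := upper_bound_fin (fun i => `|h i (S / P)|).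
have lo : G (- b) <= S.
  rewrite -[leRHS](divfK (lt0r_neq0 P0)) -csum; apply: ler_sum => i _.
  rewrite ler_wpM2l ?(ltW (pi_gt0 _))// -(h_le i) hg lerNl.
  by apply: le_trans (Hb i); rewrite -normrN ler_norm.
have up : S <= G b.
  rewrite -[leLHS](divfK (lt0r_neq0 P0)) -csum; apply: ler_sum => i _.
  rewrite ler_wpM2l ?(ltW (pi_gt0 _))// -(h_le i) hg.
  by apply: le_trans (Hb i); rewrite ler_norm.
have bb : - b <= b by rewrite ge0_cp.
have [c _ cE] : exists2 c, c \in `[- b, b]%R & G c = S.
  apply: (@IVT R G (- b) b S bb); first exact: continuous_subspaceT.
  by rewrite ge_min lo/= le_max up orbT.
by exists (fun i => g i c), c; split => // i; rewrite hg.
Unshelve. all: by end_near. Qed.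

Context (x : 'I_N -> R) (c : R).
Hypothesis x_eq : forall i, h i (x i) = c.

(** [c] acts as a Lagrange multiplier: on the hyperplane the linear terms cancel, and the difference
    of potentials is a sum of nonnegative convexity gaps, each of which it dominates. *)
Lemma potential_gap_ge0 w i : weighted_sum w = weighted_sum x ->
  pi i * (H i (w i) - H i (x i) - c * (w i - x i)) <= potential w - potential x.
Proof.
move=> wx.
have -> : potential w - potential x = \sum_i pi i * (H i (w i) - H i (x i) - c * (w i - x i)).
  transitivity (potential w - potential x - c * (weighted_sum w - weighted_sum x)).
    by rewrite wx subrr mulr0 subr0.
  rewrite /potential /weighted_sum -!sumrB mulr_sumr -sumrB.
  by apply: eq_bigr => j _; ring.
rewrite (bigD1 i)//= lerDl sumr_ge0// => j _.
rewrite mulr_ge0 ?(ltW (pi_gt0 _))//.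
by have := H_sub j (w j) (x j); rewrite x_eq; lra.
Qed.

Lemma potential_ge w : weighted_sum w = weighted_sum x -> potential x <= potential w.
Proof.
move=> /(potential_gap_ge0 i0) wx; rewrite -subr_ge0; apply: le_trans wx.
rewrite mulr_ge0 ?(ltW (pi_gt0 _))//.
by have := H_sub i0 (w i0) (x i0); rewrite x_eq; lra.
Qed.

Lemma potential_close (r : R) : 0 < r -> exists2 del, 0 < del &
  forall w, weighted_sum w = weighted_sum x -> potential w <= potential x + del ->
  forall i, `|w i - x i| <= r.
Proof.
move=> r0.
(* Strict monotonicity separates the slope at distance r/2 from [c], so the convexity gap beyond
   distance r is at least gap * (r/2); the further half in [gap0] makes the contradiction strict. *)
pose gap i := Num.min (h i (x i + r / 2) - c) (c - h i (x i - r / 2)).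
have gap0 i : 0 < pi i * (gap i * (r / 2)) / 2.
  rewrite !mulr_gt0 ?divr_gt0// lt_min !subr_gt0 -(x_eq i).
  by rewrite !h_mono// ?ltrDl ?ltrBlDr ?ltrDl divr_gt0.
have [del del0 Hdel] := pos_lower_bound gap0.
exists del => // w wx wdel i.
rewrite leNgt; apply/negP => far.
have : pi i * (gap i * (r / 2)) <= del.
  apply: le_trans (_ : potential w - potential x <= _); last by rewrite lerBlDl.
  apply: le_trans (potential_gap_ge0 i wx).
  rewrite ler_wpM2l ?(ltW (pi_gt0 _))//.
  have [wle|wgt] := leP (x i) (w i).
    have wr : x i + r < w i by move: far; rewrite ger0_norm ?subr_ge0//; lra.
    have h1 := H_sub i (w i) (x i + r / 2); have h2 := H_sub i (x i + r / 2) (x i).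
    rewrite x_eq in h2.
    have g1 : gap i <= h i (x i + r / 2) - c by rewrite ge_min lexx.
    have g0 : 0 <= h i (x i + r / 2) - c by rewrite subr_ge0 -(x_eq i) h_le lerDl divr_ge0// ltW.
    have : gap i * (r / 2) <= (h i (x i + r / 2) - c) * (r / 2) by rewrite ler_wpM2r// divr_ge0// ltW.
    have : (h i (x i + r / 2) - c) * (r / 2) <= (h i (x i + r / 2) - c) * (w i - (x i + r / 2)).
      by rewrite ler_wpM2l//; lra.
    by move: h1 h2; lra.
  have wr : w i < x i - r by move: far; rewrite ltr0_norm ?subr_lt0//; lra.
  have h1 := H_sub i (w i) (x i - r / 2); have h2 := H_sub i (x i - r / 2) (x i).
  rewrite x_eq in h2.
  have g1 : gap i <= c - h i (x i - r / 2) by rewrite ge_min lexx orbT.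
  have g0 : 0 <= c - h i (x i - r / 2) by rewrite subr_ge0 -(x_eq i) h_le lerBlDr lerDl divr_ge0// ltW.
  have : gap i * (r / 2) <= (c - h i (x i - r / 2)) * (r / 2) by rewrite ler_wpM2r// divr_ge0// ltW.
  have : (c - h i (x i - r / 2)) * (r / 2) <= (c - h i (x i - r / 2)) * ((x i - r / 2) - w i).
    by rewrite ler_wpM2l//; lra.
  by move: h1 h2; lra.
have := Hdel i; have := gap0 i; lra.
Qed.

(** Equal weighted sums give one coordinate below and one above that of [x], so [c] lies between two
    values [h i (w i)]; small spread then brings all of them near [c], and the subgradient at [w i]
    bounds each gap by |h_i(w_i) - c| |w_i - x_i|. *)
Lemma low_dissipation_low_potential (B del : R) : 0 < del -> exists2 eta, 0 < eta &
  forall w, (forall i, `|w i| <= B) -> weighted_sum w = weighted_sum x ->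
  dissipation w <= eta -> potential w <= potential x + del.
Proof.
move=> del0.
pose Q := \sum_i pi i * (`|B| + `|x i|).
have Q0 : 0 <= Q.
  by apply: sumr_ge0 => i _; rewrite mulr_ge0 ?(ltW (pi_gt0 _))// addr_ge0.
have d0 : 0 < del / (Q + 1) by rewrite divr_gt0// ltr_wpDl.
have [eta eta0 Heta] := energy_spread p_adj e_conn pi_gt0 pi_null d0.
exists eta => // w wB wx /Heta spread.
have [i1 w1] : exists i, w i <= x i by apply: weighted_sum_le; rewrite wx.
have [i2 w2] : exists i, x i <= w i by apply: weighted_sum_le; rewrite wx.
have zc i : `|h i (w i) - c| <= del / (Q + 1).
  have z1 : h i1 (w i1) <= c by rewrite -(x_eq i1) h_le.
  have z2 : c <= h i2 (w i2) by rewrite -(x_eq i2) h_le.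
  have := spread i i1; have := spread i i2; rewrite !ler_norml.
  by move=> /andP[a1 a2] /andP[a3 a4]; apply/andP; split; lra.
rewrite -lerBlDl.
have -> : potential w - potential x = \sum_i pi i * (H i (w i) - H i (x i) - c * (w i - x i)).
  transitivity (potential w - potential x - c * (weighted_sum w - weighted_sum x)).
    by rewrite wx subrr mulr0 subr0.
  rewrite /potential /weighted_sum -!sumrB mulr_sumr -sumrB.
  by apply: eq_bigr => j _; ring.
apply: (@le_trans _ _ (Q * (del / (Q + 1)))).
  rewrite /Q mulr_suml; apply: ler_sum => i _.
  rewrite -mulrA ler_wpM2l ?(ltW (pi_gt0 _))//.
  apply: (@le_trans _ _ ((h i (w i) - c) * (w i - x i))).
    by rewrite mulrBl lerD2r.
  apply: le_trans (ler_norm _) _; rewrite normrM mulrC ler_pM//.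
  apply: le_trans (ler_normB _ _) _; rewrite lerD2r.
  exact: le_trans (wB i) (ler_norm _).
rewrite mulrA ler_pdivrMr ?ltr_wpDl// mulrC ler_wpM2l ?(ltW del0)//.
by rewrite lerDl.
Qed.

End Potential.

(** * Eventual bounds and a scalar descent recursion *)

Lemma nat_upper_bound (I : finType) (f : I -> nat) : exists K, forall i, (f i <= K)%N.
Proof. by exists (\max_i f i) => i; exact: leq_bigmax. Qed.

Lemma fin_eventually (I : finType) (Q : I -> nat -> Prop) :
  (forall i, exists K, forall k, (K <= k)%N -> Q i k) ->
  exists K, forall k, (K <= k)%N -> forall i, Q i k.
Proof.
move=> ex; pose f i := projT1 (cid (ex i)).
have [K HK] := nat_upper_bound f.
exists K => k Kk i; have := HK i; rewrite /f; case: cid => /= Ki Hi KiK.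
by apply: Hi; exact: leq_trans Kk.
Qed.

Section RealSequences.
Context (R : realType).

Lemma root4_large (x : R) : exists K, forall k, (K <= k)%N -> x <= root4 R k.
Proof.
have [n xn] := archi_nat x.
exists (n ^ 4)%N => k nk; apply: le_trans xn _.
by rewrite -(@ler_pXn2r _ 4)// ?nnegrE ?root4_ge0// root4_exp4 -natrX ler_nat.
Qed.

Lemma root4_div_small (C eps : R) : 0 <= C -> 0 < eps ->
  exists K, forall k, (K <= k)%N -> C * root4 R k / k%:R <= eps.
Proof.
move=> C0 e0; have [K HK] := root4_large (C / eps).
exists K.+1 => k Kk; have k1 : (1 <= k)%N by exact: leq_ltn_trans Kk.
have := HK k (ltnW Kk); rewrite ler_pdivrMr// => h.
have t1 := root4_ge1 R k1; rewrite -[in X in _ / X](root4_exp4 R k).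
set t := root4 R k in h t1 *; have t0 : 0 < t by lra.
rewrite ler_pdivrMr ?exprn_gt0//.
apply: (@le_trans _ _ (t * eps * t)); first by rewrite ler_wpM2r// ltW.
rewrite mulrAC mulrC ler_wpM2l ?(ltW e0)// -expr2.
by rewrite ler_weXn2l.
Qed.

(** A length of order sqrt tau suffices for transients to die, and the total motion is of order
    tau^(1/2 + 1/4 - 1). The constant 12 is 6 from the length times 2 from the growth of [root4]
    over the window. *)
Lemma window_exists (n : nat) (C eps : R) : 0 <= C -> 0 < eps ->
  exists K, forall tau, (K <= tau)%N -> exists W : nat, (tau + n <= W ^ 2)%N /\
    (n + W)%:R * (C * root4 R (tau + n + W) / tau%:R) <= eps.
Proof.
move=> C0 e0; have [K HK] := root4_large (12 * C / eps).
exists (maxn K (n.+1 ^ 2)) => tau.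
rewrite geq_max => /andP[/HK htau ntau].
have [W /andP[W1 W2]] := power_block 1 (tau + n).
exists W.+1; split; first exact: ltnW.
have ntau' : (n <= tau)%N by move: ntau; clear; nia.
have nW : (n <= W)%N.
  rewrite leqNgt; apply/negP => Wn.
  have : (W.+1 ^ 2 <= n ^ 2)%N by rewrite leq_exp2r.
  by move: W2 ntau; clear; nia.
have tau1 : (1 <= tau)%N by move: ntau; clear; nia.
have Wtau : (W ^ 2 <= 2 * tau)%N by move: W1 ntau'; clear; lia.
have W0 : (1 <= W)%N by move: W2 tau1; clear; case: W => //; lia.
have Wlt : (W <= 2 * tau)%N by apply: leq_trans Wtau; move: W0; clear; nia.
have big : root4 R (tau + n + W.+1) <= 2 * root4 R tau.
  rewrite -(@ler_pXn2r _ 4)// ?nnegrE ?mulr_ge0 ?root4_ge0//.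
  rewrite exprMn !root4_exp4 -natrX -natrM ler_nat.
  by move: ntau' Wlt tau1; clear; lia.
have t1 := root4_ge1 R tau1; rewrite -(root4_exp4 R tau).
set t := root4 R tau in htau big t1 *; have t0 : 0 < t by lra.
have nWt : (n + W.+1)%:R <= 6 * t ^+ 2.
  rewrite -ler_sqr ?nnegrE ?mulr_ge0 ?exprn_ge0 ?(ltW t0)//.
  rewrite exprMn -exprM root4_exp4 -!natrX -natrM ler_nat.
  by move: nW Wtau W0; clear; nia.
apply: (@le_trans _ _ (6 * t ^+ 2 * (C * (2 * t) / t ^+ 4))).
  apply: ler_pM => //.
    by rewrite divr_ge0 ?exprn_ge0 ?(ltW t0)// mulr_ge0// root4_ge0.
  by rewrite ler_wpM2r ?invr_ge0 ?exprn_ge0 ?(ltW t0)// ler_wpM2l.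
have -> : 6 * t ^+ 2 * (C * (2 * t) / t ^+ 4) = 12 * C / t.
  by field; rewrite gt_eqF.
by rewrite ler_pdivrMr// (mulrC eps) -ler_pdivrMr.
Qed.

Lemma trunc_bound_large (cM x : R) : 0 < cM ->
  exists m0, forall m, (m0 <= m)%N -> x <= trunc_bound cM m.
Proof.
move=> cM0; have [m0 Hm] := archi_nat (expR x).
exists m0 => m mm; rewrite /trunc_bound -[leLHS]expRK ler_ln ?posrE ?expR_gt0 ?ltr_wpDl//.
apply: le_trans Hm _; apply: (@le_trans _ _ m%:R); first by rewrite ler_nat.
by rewrite lerDl ltW.
Qed.

Lemma le_trunc_bound (cM : R) (m n : nat) : 0 < cM -> (m <= n)%N ->
  trunc_bound cM m <= trunc_bound cM n.
Proof. by move=> cM0 mn; rewrite /trunc_bound ler_ln ?posrE ?ltr_wpDl// lerD2r ler_nat. Qed.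

(** Above [del] each step loses at least eta/k, so divergence of the harmonic series forces a visit
    below [del]. From there a step gains at most eta <= del, and above [del] the sequence decreases,
    so 2 * del is never exceeded again. *)
Lemma eventually_small (U E : nat -> R) (eta del : R) (K : nat) : 0 < eta -> (1 <= K)%N ->
  (forall k, (K <= k)%N -> 0 <= U k) ->
  (forall k, (K <= k)%N -> U k.+1 <= U k - k%:R^-1 * (E k - eta)) ->
  (forall k, (K <= k)%N -> 0 <= E k) ->
  (forall k, (K <= k)%N -> E k <= 2 * eta -> U k <= del) -> eta <= del ->
  exists K', forall k, (K' <= k)%N -> U k <= 2 * del.
Proof.
move=> eta0 K1 U0 step E0 low etadel.
have big k : (K <= k)%N -> del < U k -> U k.+1 <= U k - eta * k%:R^-1.
  move=> Kk Uk; apply: le_trans (step _ Kk) _; rewrite lerD2l lerN2 mulrC.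
  rewrite ler_wpM2l ?invr_ge0// lerBrDr.
  have : 2 * eta < E k by rewrite ltNge; apply/negP => /(low _ Kk); rewrite leNgt Uk.
  by lra.
have [k0 Kk0 Uk0] : exists2 k, (K <= k)%N & U k <= del.
  apply: contrapT => no.
  have {}no k : (K <= k)%N -> del < U k.
    by move=> Kk; rewrite ltNge; apply/negP => Uk; apply: no; exists k.
  apply: (@dvg_harmonic R).
  apply: nondecreasing_is_cvgn.
    by apply: nondecreasing_series => i _ _; rewrite /harmonic/= invr_ge0.
  (* [harmonic n] is 1/(n+1), hence the shift to [K.-1]. *)
  have main n : U (K + n)%N + eta * (series harmonic (K.-1 + n)%N - series harmonic K.-1) <= U K.
    elim: n => [|n IH]; first by rewrite !addn0 subrr mulr0 addr0.
    apply: le_trans IH; rewrite !addnS seriesSr.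
    have := big _ (leq_addr n K) (no _ (leq_addr n K)).
    have -> : harmonic (K.-1 + n)%N = (K + n)%:R^-1 :> R.
      by rewrite /harmonic/= -addSn prednK.
    by move: (_^-1) (series _ _) (series _ _) => a b c; lra.
  exists (series harmonic K.-1 + U K / eta) => _ [n _ <-].
  apply: (@le_trans _ _ (series harmonic (K.-1 + n)%N)).
    apply: nondecreasing_series => [i _ _|]; first by rewrite /harmonic/= invr_ge0.
    exact: leq_addl.
  rewrite -lerBlDl ler_pdivlMr// mulrC.
  by have := main n; have := U0 _ (leq_addr n K); lra.
exists k0 => k k0k; rewrite -(subnKC k0k); elim: (k - k0)%N => [|n IH].
  rewrite addn0; apply: le_trans Uk0 _; lra.
rewrite addnS.
have Kn : (K <= k0 + n)%N by rewrite (leq_trans Kk0)// leq_addr.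
have [Ule|Ugt] := leP (U (k0 + n)%N) del.
  apply: le_trans (step _ Kn) _.
  have n1 : (1 <= k0 + n)%N by exact: leq_trans Kn.
  have i0 : 0 <= (k0 + n)%:R^-1 :> R by rewrite invr_ge0.
  have i1 : (k0 + n)%:R^-1 <= 1 :> R by rewrite invf_le1 ?ltr0n// ler1n.
  have := E0 _ Kn; move: (_^-1) i0 i1 => a a0 a1 E00.
  have : 0 <= a * E (k0 + n)%N by rewrite mulr_ge0.
  have : a * eta <= 1 * eta by rewrite ler_wpM2r// ltW.
  by rewrite mulrBr; lra.
apply: le_trans (big _ Kn Ugt) _; apply: le_trans IH.
by rewrite gerBl mulr_ge0 ?invr_ge0// ltW.
Qed.

End RealSequences.

(** * Sample paths of the algorithm *)

Section Path.
Context (R : realType) (N : nat) (p : 'M[R]_N) (e : rel 'I_N) (i0 : 'I_N).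
Hypotheses (p_adj : adjacency_matrix e p) (e_conn : connected_graph e).
Context (A : 'I_N -> agent R) (ustar : 'I_N -> R) (cM : R)
  (eps : 'I_N -> 'I_N -> nat -> R) (u v y : 'I_N -> int -> R)
  (sigma : 'I_N -> nat -> nat).
Hypotheses (cM_gt0 : 0 < cM) (ustar_lt : forall i, `|ustar i| < trunc_bound cM 0)
  (dyn : forall i, agent_dynamics (A i) (u i) (v i) (y i))
  (alg : consensus_algorithm e p ustar cM eps y u sigma)
  (A_stable : forall i, stable_poly (polC (A i)))
  (A_cont : forall i, continuous (nonlin (A i)))
  (A_growth : exists2 mu : R, 0 < mu & forall i, bigO_power (nonlin (A i)) mu)
  (h_mono : forall i, {homo static_map (A i) : x x' / x < x'})
  (h_surj : forall i z, exists x, static_map (A i) x = z).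

Definition edge_noise (i : 'I_N) (k : nat) : R := \sum_(j | e j i) p i j * eps i j k.
(* The noise entering the update at step k = n.+1, which is observed at time
   k.+1. *)
Definition noise_term (i : 'I_N) (n : nat) : R := edge_noise i n.+2 / n.+1%:R.
Hypothesis noise_cvg : forall i, cvgn (series (noise_term i)).

Context (pi : 'I_N -> R) (H : 'I_N -> R -> R).
Hypotheses (pi_gt0 : forall i, 0 < pi i)
  (pi_null : forall b, \sum_i pi i * laplacian p b i = 0)
  (H_sub : forall i a b, H i b - H i a <= static_map (A i) b * (b - a)).

Local Notation h := (fun i => static_map (A i)).
Local Notation V := (potential pi H).
Local Notation E := (dissipation p pi h).
Local Notation wsum := (weighted_sum pi).

(* Adding the tail of the noise series cancels the noise in the recursion, so
   that the pi-weighted sum of the denoised controls is conserved while no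
   control is reset. *)
Definition noise_tail (i : 'I_N) (k : nat) : R :=
  limn (series (noise_term i)) - series (noise_term i) k.-1.
Definition denoised (k : nat) (i : 'I_N) : R := u i k%:Z + noise_tail i k.
Definition output_lap (i : 'I_N) (k : nat) : R :=
  laplacian p (fun j => y j k.+1%:Z) i.
Definition candidate (i : 'I_N) (k : nat) : R :=
  reset_control e ustar u sigma i k + step_size R k * innovation e p y eps i k.+1.
(** The next value of [denoised] when no control is reset at step [k]. *)
Definition drift (k : nat) (i : 'I_N) : R :=
  denoised k i - k%:R^-1 * output_lap i k.
Definition sync (m k : nat) : Prop := forall i, sigma i k = m.

Lemma noise_tail_small (r : R) : 0 < r ->
  exists K, forall k, (K <= k)%N -> forall i, `|noise_tail i k| <= r.
Proof.
move=> r0; apply: fin_eventually => i.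
have /cvgrPdist_le/(_ _ r0) [K _ HK] := noise_cvg (i := i).
exists K.+1 => -[//|k] Kk; exact: (HK k).
Qed.

Lemma noise_tailS i k : (1 <= k)%N ->
  noise_tail i k.+1 = noise_tail i k - edge_noise i k.+1 / k%:R.
Proof. by case: k => // k _; rewrite /noise_tail/= seriesSr /noise_term; ring. Qed.

Lemma innovationE i k : innovation e p y eps i k.+1 = edge_noise i k.+1 - output_lap i k.
Proof.
rewrite /innovation /edge_noise /output_lap /laplacian.
rewrite [X in _ = _ - X](bigID (fun j => e j i))/= [X in _ - (_ + X)]big1 ?addr0.
  by rewrite -sumrB; apply: eq_bigr => j _; rewrite /observed; ring.
by move=> j eji; have [_ ->] := p_adj i j; rewrite ?mul0r.
Qed.

Lemma candidate_tail i k : (1 <= k)%N ->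
  candidate i k + noise_tail i k.+1 =
  reset_control e ustar u sigma i k + noise_tail i k - k%:R^-1 * output_lap i k.
Proof.
by move=> k1; rewrite noise_tailS// /candidate innovationE /step_size; ring.
Qed.

Lemma alg_step i k : (1 <= k)%N ->
  u i k.+1%:Z = (if `|candidate i k| < trunc_bound cM (max_sigma e sigma i k)
                 then candidate i k else ustar i) /\
  sigma i k.+1 =
    (max_sigma e sigma i k + (trunc_bound cM (max_sigma e sigma i k) <= `|candidate i k|)%R)%N.
Proof. by case: alg => _; exact. Qed.

Lemma sigma_le_max i k : (sigma i k <= max_sigma e sigma i k)%N.
Proof. exact: leq_maxl. Qed.

Lemma sigma_nbr_le_max i j k : e j i -> (sigma j k <= max_sigma e sigma i k)%N.
Proof.
move=> eji; apply: leq_trans (leq_maxr _ _).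
exact: (@leq_bigmax_cond _ (fun j => e j i) (fun j => sigma j k)).
Qed.

Lemma max_sigma_le i k m : (forall j, (sigma j k <= m)%N) -> (max_sigma e sigma i k <= m)%N.
Proof. by move=> sm; rewrite geq_max sm/=; apply/bigmax_leqP. Qed.

Lemma max_sigma_leS i k : (1 <= k)%N -> (max_sigma e sigma i k <= sigma i k.+1)%N.
Proof. by move=> /(alg_step i)[_ ->]; exact: leq_addr. Qed.

Lemma sigma_homo i k l : (1 <= k)%N -> (k <= l)%N -> (sigma i k <= sigma i l)%N.
Proof.
move=> k1 /subnKC <-; elim: (l - k)%N => [|n IH]; first by rewrite addn0.
rewrite addnS (leq_trans IH)// (leq_trans (sigma_le_max _ _))// max_sigma_leS//.
by rewrite (leq_trans k1)// leq_addr.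
Qed.

(** The largest level rises by at most one per step. This makes the controls logarithmic in time and
    high levels late. *)
Lemma sigma_lt i k : (1 <= k)%N -> (sigma i k < k)%N.
Proof.
elim: k i => // -[|k] IH i _; first by case: alg => ->.
have [_ ->] := alg_step i (ltn0Sn k).
have : (max_sigma e sigma i k.+1 <= k)%N by apply: max_sigma_le => j; exact: IH.
by case: (_ <= _)%R => /=; lia.
Qed.

(** A level crosses one edge per step, and a path without repetition has fewer than [N] edges. *)
Lemma sigma_spread m i k : (1 <= k)%N -> (m <= sigma i k)%N ->
  forall j, (m <= sigma j (k + N))%N.
Proof.
move=> k1 mi j.
have /connectP[s0 /shortenP[s ps us _] ->] := e_conn i j.
have sN : (size s <= N)%N.
  have := max_card (mem (i :: s)); rewrite (card_uniqP us) card_ord /=.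
  exact: ltnW.
have main : (m <= sigma (last i s) (k + size s))%N.
  elim: s i k k1 mi ps {us sN s0} => [|j' s IH] i k k1 mi /=; first by rewrite addn0.
  move=> /andP[eij ps]; rewrite addnS -addSn; apply: IH => //.
  apply: leq_trans mi _; apply: leq_trans (max_sigma_leS _ k1).
  exact: sigma_nbr_le_max.
apply: leq_trans main _; apply: sigma_homo; last by rewrite leq_add2l.
by rewrite (leq_trans k1)// leq_addr.
Qed.

Lemma sync_max m k i : sync m k -> max_sigma e sigma i k = m.
Proof.
move=> sm; apply/eqP; rewrite eqn_leq; apply/andP; split.
  by apply: max_sigma_le => j; rewrite sm.
by have := sigma_le_max i k; rewrite (sm i).
Qed.

Lemma sync_reset m k i : sync m k -> reset_control e ustar u sigma i k = u i k%:Z.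
Proof. by move=> sm; rewrite /reset_control (sync_max _ sm) sm eqxx. Qed.

Lemma sync_candidate m k i : (1 <= k)%N -> sync m k ->
  candidate i k + noise_tail i k.+1 = drift k i.
Proof. by move=> k1 sm; rewrite candidate_tail// (sync_reset _ sm). Qed.

Lemma sync_step m k : (1 <= k)%N -> sync m k ->
  (forall i, `|drift k i - noise_tail i k.+1| < trunc_bound cM m) ->
  sync m k.+1 /\ forall i, denoised k.+1 i = drift k i.
Proof.
move=> k1 sm small.
have cm i : `|candidate i k| < trunc_bound cM m.
  by rewrite -[candidate i k](addrK (noise_tail i k.+1)) (sync_candidate _ k1 sm).
split=> i; have [uE sE] := alg_step i k1; rewrite (sync_max _ sm) in uE sE.
  by rewrite sE leNgt cm addn0.
by rewrite /denoised uE cm (sync_candidate _ k1 sm).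
Qed.

(** Unchanged levels certify that nothing was truncated, since a truncation would raise [sigma]. *)
Lemma sync_next m k : (1 <= k)%N -> sync m k -> sync m k.+1 ->
  forall i, denoised k.+1 i = drift k i /\ `|u i k.+1%:Z| < trunc_bound cM m.
Proof.
move=> k1 sm sm' i; have := alg_step i k1; rewrite (sync_max _ sm) sm'.
have [cm|cm] := ltP `|candidate i k| (trunc_bound cM m); last first.
  by case=> _ /eqP; rewrite -[X in X == _]addn0 eqn_add2l.
by case=> uE _; rewrite /denoised uE (sync_candidate _ k1 sm).
Qed.

Lemma cM_gt1 : 1 < cM.
Proof.
rewrite ltNge; apply/negP => cM1.
have := le_lt_trans (normr_ge0 _) (ustar_lt i0).
by rewrite /trunc_bound add0r ltNge ln_le0.
Qed.

Lemma u_log : exists2 c, 0 <= c & forall i k, (1 <= k)%N -> `|u i k%:Z| <= c + ln (k%:R + cM).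
Proof.
have [c c0 Hc] := upper_bound_fin (fun i => `|u i 1%:Z|).
exists c => // i [//|[|k]] _.
  by apply: ler_wpDr => //; rewrite ln_ge0// ler_wpDl// ltW// cM_gt1.
apply: ler_wpDl => //.
have sk : (max_sigma e sigma i k.+1 <= k.+2)%N.
  by apply: max_sigma_le => j; rewrite (leq_trans (ltnW (sigma_lt j (ltn0Sn k)))).
have mono := le_trunc_bound cM_gt0 sk.
have [uE _] := alg_step i (ltn0Sn k).
rewrite uE; case: ltP => [/ltW cl|_]; apply: le_trans mono => //.
apply: le_trans (ltW (ustar_lt i)) _; exact: le_trunc_bound.
Qed.

Lemma output_growth : exists2 C, 0 <= C & forall i k, (1 <= k)%N ->
  `|y i k.+1%:Z| <= C * root4 R k.
Proof.
have [c c0 uc] := u_log; have [mu mu0 fmu] := A_growth.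
have ex i : exists C, forall k, (1 <= k)%N -> `|y i k.+1%:Z| <= C * root4 R k.
  have g : exists2 mu : R, 0 < mu & bigO_power (nonlin (A i)) mu by exists mu.
  have [C C0 HC] := agent_output_growth (A_stable (i := i)) (@A_cont i) g (dyn i)
    cM_gt1 c0 (uc i).
  by exists C => k /HC[].
have [C C0 HC] := upper_bound_fin (fun i => projT1 (cid (ex i))).
exists C => // i k k1; have := HC i; case: cid => /= Ci Hi CiC.
by apply: le_trans (Hi k k1) _; rewrite ler_wpM2r ?root4_ge0.
Qed.

Lemma lap_growth : exists2 C, 0 <= C & forall i k, (1 <= k)%N ->
  `|output_lap i k| <= C * root4 R k.
Proof.
have [C C0 HC] := output_growth; have [L L0 HL] := laplacian_bound p_adj.
exists (L * C); first exact: mulr_ge0.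
move=> i k k1; rewrite -mulrA; apply: HL => [|j]; last exact: HC.
by rewrite mulr_ge0// root4_ge0.
Qed.

Lemma lap_step_small (r : R) : 0 < r ->
  exists K, forall k, (K <= k)%N -> forall i, `|k%:R^-1 * output_lap i k| <= r.
Proof.
move=> r0; have [C C0 HC] := lap_growth; have [K HK] := root4_div_small C0 r0.
exists K.+1 => k Kk i; apply: le_trans (HK k (ltnW Kk)).
rewrite normrM ger0_norm ?invr_ge0// [leRHS]mulrC ler_wpM2l ?invr_ge0// HC//.
exact: leq_ltn_trans Kk.
Qed.

Lemma h_cont i : continuous (static_map (A i)).
Proof.
rewrite /static_map; case: (kind (A i)) => x.
  by apply: cvgM; [exact: cvg_cst|exact: A_cont].
apply: (@continuous_comp _ _ _ (fun t => (polD (A i)).[1] / (polC (A i)).[1] * t) (nonlin (A i))).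
  by apply: cvgM; [exact: cvg_cst|exact: cvg_id].
exact: A_cont.
Qed.

Lemma tracking_unif (B dl : R) : 0 < dl ->
  exists2 eta, 0 < eta & exists K0 : nat, forall k0 n : nat,
    (K0 <= k0)%N -> (k0 <= n ^ 2)%N ->
    (forall i (j : nat), (k0 <= j <= k0 + n)%N -> `|u i j%:Z| <= B) ->
    (forall i (j : nat), (k0 <= j < k0 + n)%N -> `|u i j.+1%:Z - u i j%:Z| <= eta) ->
    forall i, `|y i (k0 + n).+1%:Z - h i (u i (k0 + n)%N%:Z)| <= dl.
Proof.
move=> dl0; have [c c0 uc] := u_log; have [mu mu0 fmu] := A_growth.
have ex i : exists eta, 0 < eta /\ exists K0 : nat, forall k0 n : nat,
    (K0 <= k0)%N -> (k0 <= n ^ 2)%N ->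
    (forall (j : nat), (k0 <= j <= k0 + n)%N -> `|u i j%:Z| <= B) ->
    (forall (j : nat), (k0 <= j < k0 + n)%N -> `|u i j.+1%:Z - u i j%:Z| <= eta) ->
    `|y i (k0 + n).+1%:Z - h i (u i (k0 + n)%N%:Z)| <= dl.
  have g : exists2 mu : R, 0 < mu & bigO_power (nonlin (A i)) mu by exists mu.
  have [eta eta0 HK] := agent_tracking (A_stable (i := i)) (@A_cont i) g (dyn i)
    cM_gt1 c0 (uc i) B dl0.
  by exists eta.
pose f i := projT1 (cid (ex i)).
have f0 i : 0 < f i by rewrite /f; case: cid => /= ? [].
have [eta eta0 etaf] := pos_lower_bound f0.
exists eta => //.
have exK i : exists K0, forall k, (K0 <= k)%N -> forall n : nat,
    (k <= n ^ 2)%N ->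
    (forall (j : nat), (k <= j <= k + n)%N -> `|u i j%:Z| <= B) ->
    (forall (j : nat), (k <= j < k + n)%N -> `|u i j.+1%:Z - u i j%:Z| <= eta) ->
    `|y i (k + n).+1%:Z - h i (u i (k + n)%N%:Z)| <= dl.
  have := etaf i; rewrite /f; case: cid => /= ei [_ [K0 HK]] le.
  exists K0 => k Kk n kn uB ue; apply: HK => // j /ue /le_trans; exact.
have [K0 HK] := fin_eventually exK.
by exists K0 => k0 n Kk kn uB ue i; exact: (HK k0 Kk i n kn (uB i) (ue i)).
Qed.

(** In a synchronised run an increment of [u] is a difference of two noise tails minus a vanishing
    Laplacian step, so slow variation is automatic; each of the three terms receives eta/3. *)
Lemma run_tracking (B dl : R) : 0 < dl -> exists K1, forall k0 n m,
  (K1 <= k0)%N -> (k0 <= n ^ 2)%N ->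
  (forall j, (k0 <= j <= k0 + n)%N -> sync m j) ->
  (forall i (j : nat), (k0 <= j <= k0 + n)%N -> `|u i j%:Z| <= B) ->
  forall i, `|y i (k0 + n).+1%:Z - h i (denoised (k0 + n) i)| <= dl.
Proof.
move=> dl0; have dl2 : 0 < dl / 2 by rewrite divr_gt0.
have [eta eta0 [K0 HK]] := tracking_unif B dl2.
have eta3 : 0 < eta / 3 by rewrite divr_gt0.
have [r r0 Hr] := h_unif h_cont B dl2.
have [Ka Ha] := noise_tail_small eta3.
have [Kb Hb] := noise_tail_small r0.
have [Kc Hc] := lap_step_small eta3.
exists (maxn 1 (maxn K0 (maxn Ka (maxn Kb Kc)))) => k0 n m.
rewrite !geq_max => /and5P[k1 kK0 kKa kKb kKc] kn sm uB i.
have kn0 : (k0 <= k0 + n)%N by exact: leq_addr.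
have ud i' (j : nat) : (k0 <= j < k0 + n)%N -> `|u i' j.+1%:Z - u i' j%:Z| <= eta.
  move=> /andP[kj jn].
  have s1 : sync m j by apply: sm; rewrite kj ltnW.
  have s2 : sync m j.+1 by apply: sm; rewrite jn andbT leqW.
  have [+ _] := sync_next (leq_trans k1 kj) s1 s2 i'.
  rewrite /drift /denoised => dE.
  have -> : u i' j.+1%:Z - u i' j%:Z =
      noise_tail i' j - noise_tail i' j.+1 - j%:R^-1 * output_lap i' j.
    by rewrite -[u i' j.+1%:Z](addrK (noise_tail i' j.+1)) dE; ring.
  apply: le_trans (ler_normB _ _) _.
  have h1 := Ha j (leq_trans kKa kj) i'.
  have h2 := Ha j.+1 (leq_trans kKa (leqW kj)) i'.
  have h3 := Hc j (leq_trans kKc kj) i'.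
  have := ler_normB (noise_tail i' j) (noise_tail i' j.+1).
  by move: h1 h2 h3; lra.
have t1 := HK k0 n kK0 kn uB ud i.
have t2 : `|h i (u i (k0 + n)%N%:Z) - h i (denoised (k0 + n) i)| <= dl / 2.
  apply: Hr; first by apply: uB; rewrite kn0 leqnn.
  by rewrite /denoised opprD addrA subrr add0r normrN Hb// (leq_trans kKb).
rewrite -(subrKA (h i (u i (k0 + n)%N%:Z))).
by apply: le_trans (ler_normD _ _) _; move: t1 t2; lra.
Qed.

Lemma run_descent (B eta : R) : 0 < eta -> exists K1, forall k0 n m,
  (K1 <= k0)%N -> (k0 <= n ^ 2)%N ->
  (forall j, (k0 <= j <= k0 + n)%N -> sync m j) ->
  (forall i (j : nat), (k0 <= j <= k0 + n)%N -> `|u i j%:Z| <= B) ->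
  V (drift (k0 + n)) <=
  V (denoised (k0 + n)) - (k0 + n)%:R^-1 * (E (denoised (k0 + n)) - eta).
Proof.
move=> eta0.
have [dl dl0 Hd] := descent p_adj pi_gt0 h_cont h_mono H_sub (B + 1) eta0.
have [Ka Ha] := noise_tail_small (@ltr01 R).
have [Kb Hb] := lap_step_small dl0.
have [Kc Hc] := run_tracking B dl0.
exists (maxn Ka (maxn Kb Kc)) => k0 n m; rewrite !geq_max => /and3P[ka kb kc] kn sm uB.
have kk : (k0 <= k0 + n)%N by exact: leq_addr.
apply: (Hd _ _ (fun j => y j (k0 + n).+1%:Z)) => //.
- move=> i; rewrite /denoised; apply: le_trans (ler_normD _ _) _.
  by apply: lerD; [apply: uB; rewrite kk leqnn|apply: Ha; exact: leq_trans kk].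
- move=> i; rewrite /drift opprB addrC subrK; apply: Hb; exact: leq_trans kk.
- by move=> i; exact: (Hc k0 n m).
Qed.

Lemma wsum_drift k : wsum (drift k) = wsum (denoised k).
Proof.
rewrite /weighted_sum /drift.
under eq_bigr do rewrite mulrBr mulrCA.
by rewrite sumrB -mulr_sumr pi_null mulr0 subr0.
Qed.

(** Level [m] is entered only through [ustar]: a truncation leaves just the noise tail as deviation,
    and catching up with a neighbour adds one Laplacian step. At level [m] the candidate is too
    close to [ustar] to be truncated. *)
Lemma entry_step (m k : nat) (i : 'I_N) (r D : R) : (1 <= k)%N ->
  (forall j, (sigma j k <= m)%N) ->
  `|noise_tail i k| <= 4^-1 -> `|noise_tail i k.+1| <= 4^-1 ->
  `|k%:R^-1 * output_lap i k| <= D -> 4^-1 <= r ->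
  (sigma i k = m -> `|denoised k i - ustar i| <= r) ->
  `|ustar i| + r + D + 4^-1 < trunc_bound cM m ->
  (sigma i k.+1 <= m)%N /\ (sigma i k.+1 = m -> `|denoised k.+1 i - ustar i| <= r + D).
Proof.
move=> k1 sm t0 t1 lD r4 near big.
have D0 : 0 <= D := le_trans (normr_ge0 _) lD.
have smax := max_sigma_le i sm.
have [uE sE] := alg_step i k1.
have [lt|ge] := ltnP (max_sigma e sigma i k) m.
  have [cl|cg] := ltP `|candidate i k| (trunc_bound cM (max_sigma e sigma i k)).
    rewrite sE leNgt cl addn0; split => [|sm']; first exact: ltnW.
    by move: lt; rewrite sm' ltnn.
  rewrite sE cg addn1; split => // _.
  rewrite /denoised uE ltNge cg /= addrAC subrr add0r.
  by apply: le_trans t1 _; lra.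
have sM : max_sigma e sigma i k = m by apply/eqP; rewrite eqn_leq smax.
have close : `|reset_control e ustar u sigma i k + noise_tail i k - ustar i| <= r.
  rewrite /reset_control sM; case: eqP => [/esym|_]; first exact: near.
  by rewrite addrAC subrr add0r (le_trans t0).
have cE := candidate_tail i k1.
have ct : `|candidate i k + noise_tail i k.+1 - ustar i| <= r + D.
  rewrite cE addrAC; apply: le_trans (ler_normB _ _) _; exact: lerD.
have csmall : `|candidate i k| < trunc_bound cM m.
  apply: le_lt_trans big.
  have -> : candidate i k = ustar i + (candidate i k + noise_tail i k.+1 - ustar i) - noise_tail i k.+1 by ring.
  apply: le_trans (ler_normB _ _) _.
  have := ler_normD (ustar i) (candidate i k + noise_tail i k.+1 - ustar i).
  by move: ct t1; lra.
rewrite sE sM leNgt csmall addn0; split => // _.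
by rewrite /denoised uE sM csmall.
Qed.

(* The truncation level m is first reached at time t.+1; from there on every
   agent joins it by a reset to ustar and then moves by at most D per step. *)
Lemma entry_window (m t L : nat) (D : R) : (1 <= t)%N ->
  (forall j, (sigma j t < m)%N) ->
  (forall k, (t <= k)%N -> forall i, `|noise_tail i k| <= 4^-1) ->
  (forall k, (t <= k < t + L)%N -> forall i, `|k%:R^-1 * output_lap i k| <= D) ->
  L%:R * D <= 2^-1 -> 0 <= D ->
  (forall i, `|ustar i| + 2 <= trunc_bound cM m) ->
  forall d, (d <= L)%N -> forall i, (sigma i (t + d) <= m)%N /\
    (sigma i (t + d) = m -> `|denoised (t + d) i - ustar i| <= 4^-1 + d%:R * D).
Proof.
move=> t1 sm tail lapD LD D0 big; elim=> [|d IH] dL i.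
  by rewrite addn0; split => [|E]; [exact: ltnW|have := sm i; rewrite E ltnn].
have {}IH := IH (ltnW dL).
have td : (t <= t + d)%N by exact: leq_addr.
have dD : d.+1%:R * D <= 2^-1 by apply: le_trans LD; rewrite ler_wpM2r// ler_nat.
have dE : d.+1%:R * D = d%:R * D + D by rewrite -natr1 mulrDl mul1r.
rewrite dE addrA addnS.
apply: entry_step.
- exact: leq_trans td.
- by move=> j; have [] := IH j.
- exact: tail.
- by apply: tail; exact: leqW.
- by apply: lapD; rewrite td ltn_add2l.
- by rewrite lerDl mulr_ge0.
- by move=> sE; have [_] := IH i; exact.
- apply: lt_le_trans (big i); move: dD; rewrite dE.
  by move: (d%:R * D) => q; lra.
Qed.

(** All thresholds are fixed before [m] and [t], which makes a high level inescapable. After its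
    first occurrence [N] steps equalise the levels, and [W] more let the filters settle while the
    controls stay near [ustar]; from then on a sublevel set of [V] inside the truncation bound is
    invariant. *)
Lemma trap : exists m0 K0, forall m t, (m0 <= m)%N -> (K0 <= t)%N ->
  (forall j, (sigma j t < m)%N) -> (exists i, (m <= sigma i t.+1)%N) ->
  forall k, (t + N.+1 <= k)%N -> sync m k.
Proof.
have [B0 B00 HB0] := upper_bound_fin (fun i => `|ustar i|).
have [c0 Hc0] := potential_bounded pi_gt0 h_mono H_sub (B0 + 1).
pose Sb := \sum_i pi i * (B0 + 1).
have [eta1 eta10 [B1 HB1]] := near_critical_bounded i0 p_adj e_conn pi_gt0 pi_null h_mono h_surj Sb.
have [c1 Hc1] := potential_bounded pi_gt0 h_mono H_sub B1.
(* The sublevel set contains both the restart region ([c0]) and the low-dissipation region ([c1]);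
   the extra 1 pays for one step from the latter, where [V] grows by at most eta <= 1. *)
pose V2 := Num.max c0 c1 + 1.
have [B2 HB2] := potential_coercive pi_gt0 h_surj H_sub V2.
(* [Bu] covers the controls near [ustar] during the window and on the sublevel set afterwards, noise
   tails included. *)
pose Bu := `|B2| + B0 + 2.
have Bu0 : 0 <= Bu by rewrite /Bu !addr_ge0.
pose eta := Num.min eta1 1.
have eta0 : 0 < eta by rewrite lt_min eta10 ltr01.
have [K1 HK1] := run_descent Bu eta0.
have q4 : 0 < 4^-1 :> R by rewrite invr_gt0.
have [K2 HK2] := noise_tail_small q4.
have [CL CL0 HCL] := lap_growth.
have h2 : 0 < 2^-1 :> R by rewrite invr_gt0.
have [K3 HK3] := window_exists N.+1 CL0 h2.
have [m0 Hm0] := trunc_bound_large (Bu + B0 + 3) cM_gt0.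
exists m0, (maxn 1 (maxn K1 (maxn K2 K3))) => m t mm; rewrite !geq_max.
move=> /and4P[t1 tK1 tK2 tK3] sm [i1 i1m].
have big := Hm0 m mm.
have [W [kW LD]] := HK3 t tK3.
pose k0 := (t + N.+1)%N.
pose L := (N.+1 + W)%N.
pose D := CL * root4 R (t + N.+1 + W) / t%:R.
have D0 : 0 <= D by rewrite divr_ge0// mulr_ge0// root4_ge0.
have lapD k : (t <= k < t + L)%N -> forall i, `|k%:R^-1 * output_lap i k| <= D.
  move=> /andP[tk kL] i; have k1 := leq_trans t1 tk.
  rewrite normrM ger0_norm ?invr_ge0// mulrC; apply: ler_pM => //.
    apply: le_trans (HCL i k k1) _; rewrite ler_wpM2l// le_root4//.
    by rewrite -addnA ltnW.
  by rewrite lef_pV2 ?posrE ?ltr0n// ler_nat.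
have tail k : (t <= k)%N -> forall i, `|noise_tail i k| <= 4^-1.
  by move=> tk; apply: HK2; exact: leq_trans tk.
have ub i : `|ustar i| + 2 <= trunc_bound cM m.
  by apply: le_trans big; have := HB0 i; move: Bu0; lra.
have win := entry_window t1 sm tail lapD LD D0 ub.
have syncW k : (k0 <= k <= k0 + W)%N -> sync m k.
  move=> /andP[kk kW'] i; apply/eqP; rewrite eqn_leq; apply/andP; split.
    have [] := win (k - t)%N _ i; last by rewrite subnKC// (leq_trans _ kk)// leq_addr.
    by rewrite leq_subLR addnA.
  have := sigma_spread (ltn0Sn t) i1m i; move/leq_trans; apply.
  by apply: sigma_homo => //; rewrite addSnnS.
have closeW k : (k0 <= k <= k0 + W)%N -> forall i, `|denoised k i| <= B0 + 1.
  move=> kr i; have /andP[kk kW'] := kr.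
  have tk : (t <= k)%N by rewrite (leq_trans _ kk)// leq_addr.
  have kL : (k - t <= L)%N by rewrite leq_subLR addnA.
  have [_] := win (k - t)%N kL i; rewrite subnKC// => /(_ (syncW _ kr i)).
  have le2 : (k - t)%:R * D <= 2^-1 by apply: le_trans LD; rewrite ler_wpM2r// ler_nat.
  rewrite -[denoised k i in X in _ -> X](subrK (ustar i)) => close.
  apply: le_trans (ler_normD _ _) _; have := HB0 i; move: close le2.
  by move: (_ * D) => q; lra.
have uW k : (k0 <= k <= k0 + W)%N -> forall i, `|u i k%:Z| <= Bu.
  move=> kr i; have -> : u i k%:Z = denoised k i - noise_tail i k by rewrite addrK.
  apply: le_trans (ler_normB _ _) _.
  have tk : (t <= k)%N by case/andP: kr => kk _; rewrite (leq_trans _ kk)// leq_addr.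
  have := closeW _ kr i; have := tail k tk i; have := normr_ge0 B2; rewrite /Bu; lra.
have k0t : (t <= k0)%N by exact: leq_addr.
have kWr : (k0 <= k0 + W <= k0 + W)%N by rewrite leq_addr leqnn.
have wS : `|wsum (denoised (k0 + W))| <= Sb.
  apply: le_trans (ler_norm_sum _ _ _) _; apply: ler_sum => i _.
  by rewrite normrM gtr0_norm// ler_wpM2l ?(ltW (pi_gt0 _))// closeW.
(* V <= V2 is invariant: V decreases where the dissipation exceeds eta1, and
   elsewhere the denoised controls lie in a bounded set on which V <= c1. *)
have main n : (W <= n)%N -> [/\ forall j, (k0 <= j <= k0 + n)%N -> sync m j,
    forall i (j : nat), (k0 <= j <= k0 + n)%N -> `|u i j%:Z| <= Bu,
    V (denoised (k0 + n)) <= V2 & `|wsum (denoised (k0 + n))| <= Sb].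
  move=> /subnKC <-; elim: (n - W)%N => [|d IH].
    rewrite addn0; split => //; first by move=> i j jr; exact: uW.
    apply: le_trans (Hc0 _ (closeW _ kWr)) _.
    by rewrite /V2 ler_wpDr// le_max lexx.
  rewrite addnS; set n' := (W + d)%N in IH *.
  have [IH1 IH2 IH3 IH4] := IH.
  have kn : (k0 <= n' ^ 2)%N by apply: leq_trans kW _; rewrite leq_exp2r// leq_addr.
  have kk : (k0 <= k0 + n')%N by exact: leq_addr.
  have k1 : (1 <= k0 + n')%N by rewrite (leq_trans t1)// (leq_trans k0t).
  have desc := HK1 k0 n' m (leq_trans tK1 k0t) kn IH1 IH2.
  have a0 : 0 <= (k0 + n')%:R^-1 :> R by rewrite invr_ge0.
  have a1 : (k0 + n')%:R^-1 <= 1 :> R by rewrite invf_le1 ?ltr0n// ler1n.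
  have E0 : 0 <= E (denoised (k0 + n')) by exact: energy_ge0.
  have VV : V (drift (k0 + n')) <= V2.
    have [low|high] := leP (E (denoised (k0 + n'))) eta1.
      have Vc1 := Hc1 _ (HB1 _ IH4 low).
      have cmax : c1 <= Num.max c0 c1 by rewrite le_max lexx orbT.
      have eta11 : eta <= 1 by rewrite ge_min lexx orbT.
      apply: le_trans desc _; rewrite /V2 mulrBr.
      have : 0 <= (k0 + n')%:R^-1 * E (denoised (k0 + n')) by rewrite mulr_ge0.
      have : (k0 + n')%:R^-1 * eta <= 1 * 1 by apply: ler_pM => //; exact: ltW.
      by move: (_^-1 * eta) (_^-1 * E _) => q1 q2; lra.
    apply: le_trans desc _; apply: le_trans IH3; rewrite gerBl mulr_ge0// subr_ge0.
    by apply: ltW; apply: le_lt_trans high; rewrite ge_min lexx.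
  have dB i : `|drift (k0 + n') i| <= B2 by exact: HB2.
  have tl i : `|noise_tail i (k0 + n').+1| <= 4^-1.
    by apply: tail; rewrite (leq_trans k0t)// (leq_trans kk).
  have small i : `|drift (k0 + n') i - noise_tail i (k0 + n').+1| < trunc_bound cM m.
    apply: lt_le_trans big; apply: le_lt_trans (ler_normB _ _) _.
    have := dB i; have := tl i; have := ler_norm B2; rewrite /Bu; lra.
  have snow : sync m (k0 + n') by apply: IH1; rewrite kk leqnn.
  have [snext dnext] := sync_step k1 snow small.
  have dE : denoised (k0 + n').+1 = drift (k0 + n') by apply/funext.
  rewrite addnS; split.
  - move=> j /andP[kj]; rewrite leq_eqVlt ltnS => /predU1P[-> //|jn].
    by apply: IH1; rewrite kj.
  - move=> i j /andP[kj]; rewrite leq_eqVlt ltnS => /predU1P[->|jn]; last first.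
      by apply: IH2; rewrite kj.
    have -> : u i (k0 + n').+1%:Z = denoised (k0 + n').+1 i - noise_tail i (k0 + n').+1.
      by rewrite addrK.
    rewrite dnext; apply: le_trans (ler_normB _ _) _.
    have := dB i; have := tl i; have := ler_norm B2; rewrite /Bu; lra.
  - by rewrite dE.
  - by rewrite dE wsum_drift.
move=> k kk; have [kle|kgt] := leqP k (k0 + W); first by apply: syncW; rewrite kk.
have Wn : (W <= k - k0)%N by rewrite leq_subRL// ltnW.
have [sy _ _ _] := main _ Wn; apply: sy.
by rewrite subnKC// kk leqnn.
Qed.

(** Bounded levels attain their maximum, which spreads to all agents. Otherwise [trap] applies at
    the first occurrence of [m]; as a level is smaller than its time, taking [m] above [K0] makes
    that time late enough. *)
Lemma sigma_stabilizes : exists m k0, (1 <= k0)%N /\ forall k, (k0 <= k)%N -> sync m k.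
Proof.
have [[b Hb]|unb] := pselect (exists b, forall i k, (1 <= k)%N -> (sigma i k <= b)%N).
  pose Q := [pred m : nat | `[< exists k i, (1 <= k)%N /\ sigma i k = m >]].
  have exQ : exists m, Q m by exists (sigma i0 1%N); apply/asboolP; exists 1%N, i0.
  have boundQ m : Q m -> (m <= b)%N by move=> /asboolP[k [i [k1 <-]]]; exact: Hb.
  case: (ex_maxnP exQ boundQ) => m /asboolP[k1 [i1 [k11 i1m]]] maxm.
  exists m, (k1 + N)%N; split; first by rewrite (leq_trans k11)// leq_addr.
  move=> k kk i; apply/eqP; rewrite eqn_leq; apply/andP; split.
    apply: maxm; apply/asboolP; exists k, i; split => //.
    by rewrite (leq_trans k11)// (leq_trans _ kk)// leq_addr.
  have mi : (m <= sigma i1 k1)%N by rewrite i1m.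
  apply: leq_trans (sigma_spread k11 mi i) _; apply: sigma_homo => //.
  by rewrite (leq_trans k11)// leq_addr.
have [m0 [K0 Htrap]] := trap.
pose m := (maxn m0 K0).+1.
pose Q := [pred k : nat | (1 <= k)%N && [exists i, (m <= sigma i k)%N]].
have exQ : exists k, Q k.
  apply: contrapT => noQ; apply: unb; exists m => i k k1.
  rewrite leqNgt; apply/negP => lt; apply: noQ; exists k.
  by rewrite inE k1/=; apply/existsP; exists i; exact: ltnW.
case: (ex_minnP exQ) => tau /andP[tau1 /existsP[i mi]] mintau.
have tm : (m < tau)%N by apply: leq_ltn_trans mi _; exact: sigma_lt.
case: tau tau1 mi mintau tm => // t _ mi mintau tm.
have t1 : (1 <= t)%N := leq_trans (ltn0Sn (maxn m0 K0)) (tm : (m <= t)%N).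
exists m, (t + N.+1)%N; split; first by rewrite (leq_trans t1)// leq_addr.
apply: (Htrap m t).
- by rewrite leqW// leq_maxl.
- by rewrite (leq_trans _ (tm : (m <= t)%N))// leqW// leq_maxr.
- move=> j; rewrite ltnNge; apply/negP => mj.
  have /mintau : Q t by rewrite inE t1/=; apply/existsP; exists j.
  by rewrite ltnn.
- by exists i.
Qed.

Lemma path_consensus : exists (y0 : R) (u0 : 'I_N -> R),
  [/\ forall i, (fun k : nat => y i k%:Z) @ \oo --> y0,
      forall i, (fun k : nat => u i k%:Z) @ \oo --> u0 i
    & forall i, static_map (A i) (u0 i) = y0].
Proof.
have [m [ka [ka1 sy]]] := sigma_stabilizes.
pose M := trunc_bound cM m.
pose kb := ka.+1.
have uM i (k : nat) : (kb <= k)%N -> `|u i k%:Z| <= M.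
  case: k => // k kk; have k1 : (1 <= k)%N := leq_trans ka1 (kk : (ka <= k)%N).
  by have [_ /ltW] := sync_next k1 (sy k kk) (sy k.+1 (leqW kk)) i.
have wS k : (kb <= k)%N -> wsum (denoised k) = wsum (denoised kb).
  move=> /subnKC <-; elim: (k - kb)%N => [|n IH]; first by rewrite addn0.
  have kk : (ka <= kb + n)%N by rewrite (leq_trans (leqnSn ka))// leq_addr.
  rewrite addnS -IH -[RHS]wsum_drift; congr (weighted_sum _ _); apply/funext => i.
  by have [] := sync_next (leq_trans ka1 kk) (sy _ kk) (sy _ (leqW kk)) i.
have [x [c [xc xS]]] := equilibrium_exists i0 pi_gt0 h_mono h_surj (wsum (denoised kb)).
have [Kt HKt] := noise_tail_small (@ltr01 R).
have wB k : (maxn kb Kt <= k)%N -> forall i, `|denoised k i| <= M + 1.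
  rewrite geq_max => /andP[kk kt] i; apply: le_trans (ler_normD _ _) _.
  by apply: lerD; [exact: uM|exact: HKt].
have wconv (r : R) : 0 < r -> exists K, forall k, (K <= k)%N -> forall i, `|denoised k i - x i| <= r.
  move=> r0.
  have [del del0 Hdel] := potential_close pi_gt0 h_mono H_sub xc r0.
  have del2 : 0 < del / 2 by rewrite divr_gt0.
  have [eta eta0 Heta] := low_dissipation_low_potential i0 p_adj e_conn pi_gt0 pi_null
    h_mono H_sub xc (M + 1) del2.
  (* [eta / 2] matches the threshold 2 * eta' of [eventually_small], and [del / 2] its conclusion,
     which doubles the bound. *)
  pose eta' := Num.min (eta / 2) (del / 2).
  have eta'0 : 0 < eta' by rewrite lt_min divr_gt0.
  have [K1 HK1] := run_descent M eta'0.
  pose k1 := maxn K1 (maxn kb Kt).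
  (* Runs start at the fixed time [k1]; for k >= 2 k1 the elapsed time k - k1 is at least [k1], so
     its square meets the window condition. *)
  pose K := (k1 + k1)%N.
  have k1kb : (kb <= k1)%N by rewrite /k1 !leq_max leqnn orbT.
  have k1_1 : (1 <= k1)%N by rewrite (leq_trans _ k1kb).
  have Kk k : (K <= k)%N -> (k1 <= k)%N by apply: leq_trans; exact: leq_addr.
  have Kkb k : (K <= k)%N -> (kb <= k)%N by move=> /Kk; exact: leq_trans.
  have K1' : (1 <= K)%N by rewrite (leq_trans k1_1)// leq_addr.
  have [K' HK'] : exists K', forall k, (K' <= k)%N ->
      V (denoised k) - V x <= 2 * (del / 2).
    apply: (@eventually_small R (fun k => V (denoised k) - V x) (fun k => E (denoised k))
      eta' (del / 2) K) => // [k kk|k kk|k kk|k kk Ek|].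
    - by rewrite subr_ge0; apply: (potential_ge i0 pi_gt0 H_sub xc); rewrite xS; exact: wS (Kkb k kk).
    - have kka : (ka <= k)%N := ltnW (Kkb k kk).
      have kr : (k1 + (k - k1))%N = k by rewrite subnKC// Kk.
      have k1n : (k1 <= (k - k1) ^ 2)%N.
        have h : (k1 <= k - k1)%N by rewrite leq_subRL// Kk.
        by move: h k1_1; clear; nia.
      have -> : denoised k.+1 = drift k.
        by apply/funext => i; have [] := sync_next (leq_trans ka1 kka) (sy _ kka) (sy _ (leqW kka)) i.
      have := HK1 k1 (k - k1)%N m (leq_maxl _ _) k1n; rewrite kr => HK1k.
      rewrite [leRHS]addrAC lerD2r; apply: HK1k.
        by move=> j /andP[kj _]; apply: sy; rewrite (leq_trans _ kj)// (leq_trans _ k1kb)// leqnSn.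
      by move=> i j /andP[kj _]; apply: uM; rewrite (leq_trans _ kj).
    - exact: energy_ge0.
    - have : V (denoised k) <= V x + del / 2; last by lra.
      apply: Heta; last 2 first.
      + by rewrite xS; exact: wS (Kkb k kk).
      + apply: le_trans Ek _; rewrite -ler_pdivlMl// mulrC.
        by rewrite ge_min lexx.
      by apply: wB; rewrite (leq_trans _ (Kk k kk))// leq_maxr.
    - by rewrite ge_min lexx orbT.
  exists (maxn K' kb) => k; rewrite geq_max => /andP[kK' kkb] i.
  apply: Hdel; first by rewrite xS; exact: wS.
  by have := HK' k kK'; lra.
exists c, x; split => // i; apply/cvgrPdist_le => r r0.
  have r2 : 0 < r / 2 by rewrite divr_gt0.
  have [B _ HB] := upper_bound_fin (fun i => `|x i|).
  have [q q0 Hq] := h_unif h_cont B r2.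
  have [Ka HKa] := wconv q q0.
  have [Kc HKc] := run_tracking M r2.
  pose k1 := maxn Kc kb.
  exists (maxn Ka (k1 + k1).+1).+1 => //= -[//|k] kk.
  have {}kk : (maxn Ka (k1 + k1).+1 <= k)%N by [].
  move: kk; rewrite geq_max => /andP[kKa kk1].
  have k1k : (k1 <= k)%N by rewrite (leq_trans _ (ltnW kk1))// leq_addr.
  have kr : (k1 + (k - k1))%N = k by rewrite subnKC.
  have k1n : (k1 <= (k - k1) ^ 2)%N.
    have h : (k1 < k - k1)%N by rewrite ltn_subRL.
    by move: h; clear; nia.
  have k1kb : (kb <= k1)%N by exact: leq_maxr.
  have := HKc k1 (k - k1)%N m (leq_maxl _ _) k1n; rewrite kr => HK.
  have t1 : `|y i k.+1%:Z - static_map (A i) (denoised k i)| <= r / 2.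
    apply: HK => [j /andP[kj _]|j l /andP[kj _]].
      by apply: sy; rewrite (leq_trans _ kj)// (leq_trans _ k1kb)// leqnSn.
    by apply: uM; rewrite (leq_trans _ kj).
  have t2 : `|static_map (A i) (x i) - static_map (A i) (denoised k i)| <= r / 2.
    by apply: Hq; [exact: HB|rewrite distrC; exact: HKa].
  rewrite -(xc i) -(subrKA (static_map (A i) (denoised k i))).
  apply: le_trans (ler_normD _ _) _.
  by rewrite distrC in t1; move: t1 t2; lra.
have r2 : 0 < r / 2 by rewrite divr_gt0.
have [Ka HKa] := wconv _ r2.
have [Kc HKc] := noise_tail_small r2.
exists (maxn Ka Kc) => //= k /=; rewrite geq_max => /andP[ka' kc].
rewrite (_ : x i - u i k%:Z = noise_tail i k - (denoised k i - x i)); last by rewrite /denoised; ring.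
apply: le_trans (ler_normB _ _) _.
by have := HKa k ka' i; have := HKc k kc i; lra.
Qed.

End Path.

(** * Convergence of the noise series *)

Section NoiseSeries.
Context d (T : measurableType d) (R : realType) (P : probability T R).

Lemma Lfun2_expectation_sqr (X : {RV P >-> R}) (C : R) :
  ('E_P[fun w => (`|X w| ^+ 2)%R] <= C%:E)%E -> (X : T -> R) \in Lfun P 2%:E.
Proof.
rewrite unlock => XC.
rewrite inE; apply/andP; split; rewrite inE/=; first exact: measurable_funPT.
rewrite /finite_norm unlock /Lnorm /= poweR_lty//.
apply: le_lt_trans (ltry C); apply: le_trans XC.
rewrite le_eqVlt; apply/orP; left; apply/eqP; apply: eq_integral => w _.
by rewrite powR_mulrn.
Qed.

Lemma independent_series_cvg (I : choiceType) (D : set I) (X : I -> {RV P >-> R})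
    (f : nat -> I) (C : R) :
  mutually_independent D X -> (forall n, D (f n)) -> injective f ->
  (forall n, 'E_P[X (f n)] = 0)%E ->
  (forall n, 'E_P[fun w => (`|X (f n) w| ^+ 2)%R] <= C%:E)%E ->
  {ae P, forall w, cvgn (series (fun n => X (f n) w / n.+1%:R))}.
Proof.
move=> indep Df injf mean0 var.
have lX n : (X (f n) : T -> R) \in Lfun P 2%:E by exact: Lfun2_expectation_sqr (var n).
apply: (@uncorrelated_series_cvg _ _ _ _ (fun n => X (f n)) C) => //.
  move=> k l kl; apply: indep_expectationM => // B1 B2 mB1 mB2.
  have fkl : f k != f l by apply: contra kl => /eqP/injf ->.
  (* On the pair {f k, f l} the product formula becomes the factorisation over rectangles. *)
  pose B i := if i == f k then B1 else B2.
  have mB i : measurable (B i) by rewrite /B; case: ifP.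
  have := indep [fset f k; f l]%fset B _ mB.
  rewrite big_fsetU1/= ?inE// big_seq_fset1 /B eqxx eq_sym (negPf fkl) => <-.
    congr (P _); apply/seteqP; split => w /=.
      move=> [w1 w2] i /=; rewrite !inE => /orP[/eqP ->|/eqP ->].
        by rewrite eqxx.
      by rewrite eq_sym (negPf fkl).
    move=> Hw; split.
      by have := Hw (f k); rewrite /= !inE eqxx; exact.
    by have := Hw (f l); rewrite /= !inE eqxx orbT eq_sym (negPf fkl); exact.
  by move=> i /=; rewrite !inE => /orP[/eqP ->|/eqP ->]; exact: Df.
move=> n; under [X in expectation P X]eq_fun do rewrite -(real_normK (num_real _)).
exact: var.
Qed.

End NoiseSeries.

Lemma cvg_series_weighted_sum (R : realType) (I : Type) (r : seq I) (Q : pred I)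
    (c : I -> R) (t : I -> nat -> R) :
  (forall i, Q i -> cvgn (series (t i))) ->
  cvgn (series (fun n => \sum_(i <- r | Q i) c i * t i n)).
Proof.
move=> ct; elim: r => [|i r IH].
  rewrite (_ : series _ = cst 0); first exact: is_cvg_cst.
  by apply/funext => n; rewrite /series/= big1// => k _; rewrite big_nil.
have [Qi|Qi] := boolP (Q i); last first.
  rewrite (_ : (fun n => _) = (fun n => \sum_(i <- r | Q i) c i * t i n))//.
  by apply/funext => n; rewrite big_cons (negPf Qi).
rewrite (_ : series _ = (cst (c i) \* series (t i)) \+
    series (fun n => \sum_(i <- r | Q i) c i * t i n)).
  apply: is_cvgD => //; apply: is_cvgM; [exact: is_cvg_cst|exact: ct].
apply/funext => n; rewrite /series/= mulr_sumr -big_split/=.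
by apply: eq_bigr => k _; rewrite big_cons Qi.
Qed.

Lemma cvg_col (R : realType) (N : nat) (x : 'I_N -> nat -> R) (l : 'cV[R]_N) :
  (forall i, x i @ \oo --> l i 0) -> (fun k => \col_i x i k) @ \oo --> l.
Proof.
move=> xl; apply/cvg_ballP => r r0.
have : \forall k \near \oo, forall i, ball (l i 0) r (x i k).
  by apply: filter_forall => i; have /cvg_ballP := xl i; apply.
by apply: filterS => k Hk; split=> // i j; rewrite mxE ord1.
Qed.

Theorem theorem8 (R : realType) (d : measure_display) (T : measurableType d)
  (P : probability T R) (N : nat)
  (e : rel 'I_N) (p : 'M[R]_N) (A : 'I_N -> agent R)
  (ustar : 'I_N -> R) (cM : R)
  (eps : 'I_N -> 'I_N -> nat -> {RV P >-> R})
  (u v y : 'I_N -> int -> T -> R) (sigma : 'I_N -> nat -> T -> nat)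
  (e_undirected : undirected_graph e)
  (p_adjacency : adjacency_matrix e p)
  (cM_gt0 : 0 < cM)
  (ustar_lt : forall i, `|ustar i| < trunc_bound cM 0)
  (dynamics : forall (w : T) (i : 'I_N),
     agent_dynamics (A i) (fun k => u i k w) (fun k => v i k w)
                    (fun k => y i k w))
  (algorithm : forall w : T,
     consensus_algorithm e p ustar cM
       (fun i j k => eps i j k w) (fun i k => y i k w) (fun i k => u i k w)
       (fun i k => sigma i k w))
  (A1 : forall i, stable_poly (polC (A i)))
  (A2i : forall i, continuous (nonlin (A i)))
  (A2ii : exists2 mu : R, 0 < mu & forall i, bigO_power (nonlin (A i)) mu)
  (A2iii : forall i,
     {homo static_map (A i) : x x' / x < x'} /\
     range (static_map (A i)) = setT)
  (A3_indep : mutually_independent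
     [set ijk : 'I_N * 'I_N * nat | e ijk.1.2 ijk.1.1 /\ (1 <= ijk.2)%N]
     (fun ijk => eps ijk.1.1 ijk.1.2 ijk.2))
  (A3_mean : forall i j k, e j i -> (1 <= k)%N -> ('E_P[eps i j k] = 0)%E)
  (A3_var : forall i j, e j i ->
     (ereal_sup [set 'E_P[(fun w => `|eps i j k w| ^+ 2)%R]
                | k in [set k : nat | (1 <= k)%N]] < +oo)%E)
  (A4 : connected_graph e) :
  exists (y0 : T -> R) (u0 : T -> 'cV[R]_N),
    {ae P, forall w,
       [/\ forall i, (fun k : nat => y i k%:Z w) @ \oo --> y0 w,
           (fun k : nat => \col_i u i k%:Z w) @ \oo --> u0 w
         & const_mx (y0 w) = static_map_vec A (u0 w)]}.
Proof.
(* Without agents every claim is vacuous; otherwise [i0] supplies a base point for the weights and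
   the equilibrium. *)
have [i0 _|noI] := pickP 'I_N; last first.
  exists (fun=> 0), (fun=> 0); apply: aeW => w; split.
  - by move=> i; have := noI i.
  - by apply: cvg_col => i; have := noI i.
  - by apply/colP => i; have := noI i.
have [e_sym _] := e_undirected.
have noise_ae i j : {ae P, forall w, e j i -> cvgn (series (fun n => eps i j n.+2 w / n.+1%:R))}.
  have [eji|_] := boolP (e j i); last by apply: aeW.
  have sup_fin : exists C : R, forall k, (1 <= k)%N -> ('E_P[(fun w => `|eps i j k w| ^+ 2)%R] <= C%:E)%E.
    have := A3_var i j eji; set s := ereal_sup _ => slt.
    have le_s k : (1 <= k)%N -> ('E_P[(fun w => `|eps i j k w| ^+ 2)%R] <= s)%E.
      by move=> k1; apply: ereal_sup_ubound; exists k.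
    have s0 : (0 <= s)%E.
      apply: le_trans (le_s 1%N isT); apply: expectation_ge0 => w; exact: exprn_ge0.
    by exists (fine s) => k k1; rewrite fineK ?ge0_fin_numE//; exact: le_s.
  have [C HC] := sup_fin.
  have : {ae P, forall w, cvgn (series (fun n => eps i j n.+2 w / n.+1%:R))}.
    apply: (independent_series_cvg (f := fun n => (i, j, n.+2)) A3_indep) => //=.
    - by move=> n m [].
    - by move=> n; exact: A3_mean.
    - by move=> n; exact: HC.
  by apply: filterS => w.
have [pi pi0 pi_null] := left_null_weights p_adjacency e_sym A4 i0.
have h_surj i z : exists x, static_map (A i) x = z.
  have [_ rg] := A2iii i; have : range (static_map (A i)) z by rewrite rg.
  by case=> x _ <-; exists x.
have h_mono i := proj1 (A2iii i).
have exH i : exists H : R -> R, forall a b, H b - H a <= static_map (A i) b * (b - a).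
  apply: continuous_nondecreasing_primitive; first exact: h_cont.
  exact: ltW_homo.
pose H i : R -> R := projT1 (cid (exH i)).
have H_sub i a b : H i b - H i a <= static_map (A i) b * (b - a) by rewrite /H; case: cid.
pose good w := [set yu : R * 'cV[R]_N |
  [/\ forall i, (fun k : nat => y i k%:Z w) @ \oo --> yu.1,
      (fun k : nat => \col_i u i k%:Z w) @ \oo --> yu.2
    & const_mx yu.1 = static_map_vec A yu.2]].
(* The limits are selected sample by sample, with default (0, 0) where convergence fails. *)
pose yu w := xget (0, 0) (good w).
exists (fun w => (yu w).1), (fun w => (yu w).2).
have : {ae P, forall w, forall i j, e j i -> cvgn (series (fun n => eps i j n.+2 w / n.+1%:R))}.
  by apply: filter_forall => i; apply: filter_forall => j; exact: noise_ae.
apply: filterS => w cvg_w.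
suff /xgetPex : exists x, good w x by exact.
have noise_cvg i : cvgn (series (noise_term p e (fun i j k => eps i j k w) i)).
  rewrite (_ : noise_term _ _ _ i =
      (fun n => \sum_(j | e j i) p i j * (eps i j n.+2 w / n.+1%:R))).
    exact: (@cvg_series_weighted_sum R _ (index_enum _) (fun j => e j i) (p i) _ (cvg_w i)).
  apply/funext => n; rewrite /noise_term /edge_noise mulr_suml.
  by apply: eq_bigr => j _; rewrite mulrA.
have [y0 [u0 [yc uc hE]]] := path_consensus i0 p_adjacency A4 cM_gt0 ustar_lt
  (dynamics w) (algorithm w) A1 A2i A2ii h_mono h_surj noise_cvg pi0 pi_null H_sub.
exists (y0, \col_i u0 i); split => //=.
  by apply: cvg_col => i; rewrite mxE; exact: uc.
by apply/colP => i; rewrite !mxE hE.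
Qed.
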